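(* Let $S=(-\frac\pi2,\frac\pi2)^2$. There exists $h_0>0$ such that for any $h>h_0$, any eigenfunction of the $h$-Robin Laplacian on $S$ corresponding to the eigenvalue $\frac1{\pi^2}\left(\alpha_0(h)^2+\alpha_2(h)^2\right)$ has $2$, $3$ or $4$ nodal domains. More precisely, there are three critical values $\theta_j^*\in[0,\pi)$ ($j=1,2,3$), $$\theta_1^*(h)=\arctan\left(-\frac1{q_2(h)}\right),\qquad \theta_2^*(h)=\frac\pi2-\theta_1^*(h),\qquad \theta_3^*=\frac{3\pi}4,$$ where $$q_2(h)=\frac{\cos\left(\frac{\alpha_2(h)}2\right)}{\cos\left(\frac{\alpha_0(h)}2\right)},$$ such that the function $\Phi_{h,\theta}$ defined on $S$ by $$\Phi_{h,\theta}(x,y)=\cos\theta\,\cos\left(\frac{\alpha_0(h)x}\pi\right)\cos\left(\frac{\alpha_2(h)y}\pi\right)+\sin\theta\,\cos\left(\frac{\alpha_2(h)x}\pi\right)\cos\left(\frac{\alpha_0(h)y}\pi\right)$$ has: (i) $3$ nodal domains for $\theta\in[0,\theta_1^*(h)]$; (ii) $2$ nodal domains for $\theta\in(\theta_1^*(h),\theta_2^*(h))$; (iii) $3$ nodal domains for $\theta\in[\theta_2^*(h),\theta_3^* )$; (iv) $4$ nodal domains for $\theta=\theta_3^*$; (v) $3$ nodal domains for $\theta\in(\theta_3^*,\pi)$.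
   Context: For $h\in(0,+\infty)$, the $h$-Robin Laplacian on $S$ is $-\Delta$ with boundary condition $\partial_\nu u+hu=0$ on $\partial S$ ($\nu$ the outward unit normal). For an even non-negative integer $p$ and $h>0$, $\alpha_p(h)$ is the solution in $[p\pi,(p+1)\pi)$ of $\alpha\tan(\alpha/2)=h\pi$. The nodal domains of a function $u$ on $S$ are the connected components of $S\setminus u^{-1}(0)$. *)

(* Defs.v *)
From mathcomp Require Import all_boot all_order all_algebra.
From mathcomp Require Import all_classical all_reals all_analysis.

Set Implicit Arguments.
Unset Strict Implicit.
Unset Printing Implicit Defensive.

Import Order.TTheory GRing.Theory Num.Theory.
Import numFieldNormedType.Exports.

Local Open Scope classical_set_scope.
Local Open Scope ring_scope.

Section RobinSquare.
Variable R : realType.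
Implicit Types (p q nu : R * R) (u : R * R -> R) (h a theta lambda : R).

Definition square : set (R * R) :=
  [set p | (- (pi / 2) < p.1 < pi / 2) && (- (pi / 2) < p.2 < pi / 2)].

Definition dirx : R * R := (1, 0).
Definition diry : R * R := (0, 1).

Definition laplacian u p : R := 'D_dirx ('D_dirx u) p + 'D_diry ('D_diry u) p.

(* [outward_normal q nu]: q lies on an open side of the square, where the
   outward unit normal is nu; there is no normal at the four corners. *)
Inductive outward_normal : R * R -> R * R -> Prop :=
| normal_right t : - (pi / 2) < t < pi / 2 -> outward_normal (pi / 2, t) dirx
| normal_left t : - (pi / 2) < t < pi / 2 -> outward_normal (- (pi / 2), t) (- dirx)
| normal_top t : - (pi / 2) < t < pi / 2 -> outward_normal (t, pi / 2) diry
| normal_bottom t : - (pi / 2) < t < pi / 2 -> outward_normal (t, - (pi / 2)) (- diry).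

(* Functions on the square are represented by total functions on the plane.
   All the conditions below depend only on their values in the open square. *)

Definition C1_square u : Prop := forall p, square p ->
  {for p, continuous u} /\
  forall e, e = dirx \/ e = diry -> derivable u p e /\ {for p, continuous ('D_e u)}.

Definition C2_square u : Prop :=
  C1_square u /\ C1_square ('D_dirx u) /\ C1_square ('D_diry u).

Definition extends_to_closure u : Prop := forall q, closure square q ->
  cvg (u @ within square (nbhs q)).

Definition C1_closed_square u : Prop :=
  [/\ C1_square u, extends_to_closure u,
      extends_to_closure ('D_dirx u) & extends_to_closure ('D_diry u)].

(* The boundary values of u and of its gradient are those of their continuous
   extensions from the open square to the closed one. *)
Definition robin_condition h u : Prop := forall q nu, outward_normal q nu ->
  (fun p => 'D_nu u p + h * u p) @ within square (nbhs q) --> (0 : R).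

Definition robin_eigenfunction h lambda u : Prop :=
  [/\ C2_square u, C1_closed_square u,
      exists2 p, square p & u p != 0,
      forall p, square p -> - laplacian u p = lambda * u p
    & robin_condition h u].

Definition nodal_domains u : set (set (R * R)) :=
  [set connected_component (square `\` u @^-1` [set 0]) p
     | p in square `\` u @^-1` [set 0]].

Definition has_nodal_domains u (n : nat) : Prop := (nodal_domains u #= `I_n)%card.

(* Meaningful for p even and h > 0, where the solution exists and is unique;
   tan (a / 2) is then never evaluated at a pole. *)
Definition alpha (p : nat) h : R :=
  get [set a | p%:R * pi <= a < p.+1%:R * pi /\ a * tan (a / 2) = h * pi].

Definition lambda02 h : R := (pi ^+ 2)^-1 * (alpha 0 h ^+ 2 + alpha 2 h ^+ 2).

Definition q2 h : R := cos (alpha 2 h / 2) / cos (alpha 0 h / 2).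

Definition theta1 h : R := atan (- (q2 h)^-1).
Definition theta2 h : R := pi / 2 - theta1 h.
Definition theta3 : R := 3 * pi / 4.

Definition Phi h theta (p : R * R) : R :=
  cos theta * cos (alpha 0 h * p.1 / pi) * cos (alpha 2 h * p.2 / pi)
  + sin theta * cos (alpha 2 h * p.1 / pi) * cos (alpha 0 h * p.2 / pi).

End RobinSquare.

Arguments theta3 {R}.

(* Main.v *)
Require Import Defs.
From mathcomp Require Import all_boot all_order all_algebra.
From mathcomp Require Import all_classical all_reals all_analysis.
From mathcomp Require Import ring lra.
Set Implicit Arguments.
Unset Strict Implicit.
Unset Printing Implicit Defensive.
Import Order.TTheory GRing.Theory Num.Theory.
Import numFieldNormedType.Exports.
Local Open Scope classical_set_scope.
Local Open Scope ring_scope.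

(** The proof has two halves.

    _The eigenspace._ Write [b] for half the side of the square and [k_j] for
    the frequency with [k_j * pi = alpha_j], so that [cos (k_0 x)], [sin (k_1 x)],
    [cos (k_2 x)] are the three lowest one-dimensional Robin modes, and the
    eigenvalue is [k_0 ^ 2 + k_2 ^ 2], close to 10 when [h] is large. Integrating
    an eigenfunction [u] in [x] against a mode of frequency [k] gives a function
    of [y] that solves the one-dimensional Robin problem for the frequency
    [sqrt (k_0 ^ 2 + k_2 ^ 2 - k ^ 2)] ([coefficient_ode]). For the modes 0 and 2
    it is therefore a multiple of the complementary cosine, and for the mode 1
    it vanishes, because [sqrt 6] stays away from all Robin frequencies
    ([middle_frequency]). Subtracting the two products of cosines leaves a
    solution [g] each of whose slices is orthogonal to the three modes. The fourth
    one-dimensional eigenvalue is close to 16, and Courant's nodal argument together with an explicit Riccati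
    solution ([robin_form_ge0]) shows that the one-dimensional Robin form with
    parameter [k_0 ^ 2 + k_2 ^ 2] is nonnegative on such slices. Hence the squared
    norm [G y] of the slice is convex, whereas the Robin conditions make [G']
    equal to [- 2 h G] at the top and [2 h G] at the bottom; so [G = 0] and [u] is
    a combination of the two products ([robin_solution_family]). The eigenfunction
    is only twice differentiable inside the square, so the computation is done on
    shorter slices and passed to the limit ([derive_uniform_limit]).

    _The nodal domains._ Let [A], [B] be the two cosines and [r = B / A]. Up to the
    positive factor [A x * A y], the combination [A x B y + c B x A y] is
    [r y + c r x]. A Wronskian computation shows that the even function [r]
    decreases from [1] at the centre to [q < -1] at the side
    ([ratio_decreasing], [ratio_side_lt]), so that everything depends on [c] and [q]
    alone. If [-1 < c <= - 1 / q], each vertical line meets the nodal set in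
    exactly two points, symmetric about the axis, which gives one domain around
    the axis and two others ([three_domains]). If [- 1 / q < c < - q], the positive
    set is star-like around the centre and the negative set contains a frame along
    the boundary ([two_domains]). For [c = -1] the nodal set is the union of the
    diagonals ([four_domains]). The remaining values of [c] follow by exchanging
    the two variables, which replaces [c] by [1 / c]. *)


(** * Pointwise continuity and derivatives *)

Section Calculus.
Variable R : realType.

Section Continuity.
Variable T : topologicalType.
Implicit Types f g : T -> R.

Lemma cont_cst (k : R) : continuous (fun _ : T => k).
Proof. exact: cst_continuous. Qed.

Lemma contN f : continuous f -> continuous (fun x => - f x).
Proof. by move=> cf x; apply: cvgN; exact: cf. Qed.

Lemma contD f g : continuous f -> continuous g -> continuous (fun x => f x + g x).
Proof. by move=> cf cg x; apply: cvgD; [exact: cf|exact: cg]. Qed.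

Lemma contM f g : continuous f -> continuous g -> continuous (fun x => f x * g x).
Proof. by move=> cf cg x; apply: cvgM; [exact: cf|exact: cg]. Qed.

Lemma contX f n : continuous f -> continuous (fun x => f x ^+ n).
Proof.
move=> cf; elim: n => [|n ih]; first exact: cont_cst.
have -> : (fun x => f x ^+ n.+1) = (fun x => f x * f x ^+ n).
  by apply/funext => x; rewrite exprS.
exact: contM.
Qed.

Lemma cont_comp (h : R -> R) f : continuous h -> continuous f ->
  continuous (fun x => h (f x)).
Proof. by move=> ch cf x; apply: continuous_comp; [exact: cf|exact: ch]. Qed.

Lemma cont_pair f g : continuous f -> continuous g -> continuous (fun x => (f x, g x)).
Proof. by move=> cf cg x; apply: (cvg_pair (cf x) (cg x)). Qed.

Lemma cont_sin f : continuous f -> continuous (fun x => sin (f x)).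
Proof. by apply: cont_comp; exact: continuous_sin. Qed.

Lemma cont_cos f : continuous f -> continuous (fun x => cos (f x)).
Proof. by apply: cont_comp; exact: continuous_cos. Qed.

Lemma cont_comp2 (h : R * R -> R) f g : continuous h -> continuous f -> continuous g ->
  continuous (fun x => h (f x, g x)).
Proof.
move=> ch cf cg x; apply: (@continuous_comp _ _ _ (fun x => (f x, g x)) h).
  exact: cont_pair.
exact: ch.
Qed.

Lemma cont_norm f : continuous f -> continuous (fun x => `|f x|).
Proof. by apply: cont_comp; exact: norm_continuous. Qed.

End Continuity.

Lemma cont_id : continuous (fun x : R => x).
Proof. by move=> x; exact: cvg_id. Qed.

Lemma cont_fst : continuous (fun p : R * R => p.1).
Proof. by move=> p; exact: cvg_fst. Qed.

Lemma cont_snd : continuous (fun p : R * R => p.2).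
Proof. by move=> p; exact: cvg_snd. Qed.

Lemma cont_mull (k : R) : continuous ( *%R k).
Proof. by apply: contM; [exact: cont_cst|exact: cont_id]. Qed.

Implicit Types (f g : R -> R) (x k : R).

Lemma der_cst k x : is_derive x 1 (fun _ : R => k) 0.
Proof. exact: is_derive_cst. Qed.

Lemma der_id x : is_derive x 1 (fun y : R => y) 1.
Proof. exact: is_derive_id. Qed.

Lemma derN f x df : is_derive x 1 f df -> is_derive x 1 (fun y => - f y) (- df).
Proof. by move=> hf; apply: is_deriveN. Qed.

Lemma derD f g x df dg : is_derive x 1 f df -> is_derive x 1 g dg ->
  is_derive x 1 (fun y => f y + g y) (df + dg).
Proof. by move=> hf hg; apply: is_deriveD. Qed.

Lemma derM f g x df dg : is_derive x 1 f df -> is_derive x 1 g dg ->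
  is_derive x 1 (fun y => f y * g y) (f x * dg + g x * df).
Proof. by move=> hf hg; apply: is_deriveM. Qed.

Lemma derX f x df n : is_derive x 1 f df ->
  is_derive x 1 (fun y => f y ^+ n.+1) (n.+1%:R * f x ^+ n * df).
Proof.
by move=> hf; have := is_deriveX n.+1 hf; rewrite exprfctE.
Qed.

Lemma der_comp (h : R -> R) f x dh df : is_derive (f x) 1 h dh ->
  is_derive x 1 f df -> is_derive x 1 (fun y => h (f y)) (dh * df).
Proof. by move=> hh hf; apply: is_derive1_comp. Qed.

Lemma der_mull k x : is_derive x 1 ( *%R k) k.
Proof.
rewrite -[X in is_derive _ _ _ X](_ : k * 1 + x * 0 = k); last by rewrite mulr1 mulr0 addr0.
exact: (derM (der_cst k x) (der_id x)).
Qed.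

Lemma der_sin f x df : is_derive x 1 f df ->
  is_derive x 1 (fun y => sin (f y)) (cos (f x) * df).
Proof. by move=> hf; apply: der_comp. Qed.

Lemma der_cos f x df : is_derive x 1 f df ->
  is_derive x 1 (fun y => cos (f y)) (- sin (f x) * df).
Proof. by move=> hf; apply: der_comp. Qed.

Lemma der_cont f x df : is_derive x 1 f df -> {for x, continuous f}.
Proof.
move=> hf; apply/differentiable_continuous/derivable1_diffP.
exact: ex_derive.
Qed.

End Calculus.

(** [cont] and [der] follow the syntax of the function; matching on the head
    symbol keeps unification from unfolding it. *)
Ltac cont := lazymatch goal with
  | |- continuous (fun x => x) => exact: cont_id
  | |- continuous (fun x => x.1) => exact: cont_fst
  | |- continuous (fun x => x.2) => exact: cont_snd
  | |- continuous (fun x => @?f x + @?g x) => apply: contD; cont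
  | |- continuous (fun x => - (@?f x)) => apply: contN; cont
  | |- continuous (fun x => @?f x * @?g x) => apply: contM; cont
  | |- continuous (fun x => (@?f x) ^+ _) => apply: contX; cont
  | |- continuous (fun x => `|@?f x|) => apply: cont_norm; cont
  | |- continuous (fun x => sin (@?f x)) => apply: cont_sin; cont
  | |- continuous (fun x => cos (@?f x)) => apply: cont_cos; cont
  | |- continuous (fun x => (@?f x, @?g x)) => apply: cont_pair; cont
  | |- continuous (fun x => _) => first [exact: cont_cst | assumption | idtac]
  | |- _ => first [assumption | exact: cont_fst | exact: cont_snd | exact: cont_mull
                  | exact: continuous_sin | exact: continuous_cos | idtac]
  end.

Ltac der := lazymatch goal with
  | |- is_derive _ _ ( *%R _) _ => exact: der_mull
  | |- is_derive _ _ (fun y => y) _ => exact: der_id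
  | |- is_derive _ _ (fun y => @?f y + @?g y) _ => eapply derD; der
  | |- is_derive _ _ (fun y => - (@?f y)) _ => eapply derN; der
  | |- is_derive _ _ (fun y => @?f y * @?g y) _ => eapply derM; der
  | |- is_derive _ _ (fun y => (@?f y) ^+ _) _ => eapply derX; der
  | |- is_derive _ _ (fun y => sin (@?f y)) _ => eapply der_sin; der
  | |- is_derive _ _ (fun y => cos (@?f y)) _ => eapply der_cos; der
  | |- is_derive _ _ (fun y => _) _ => first [exact: der_cst | eassumption | idtac]
  | |- _ => first [eassumption | idtac]
  end.

(** Leaves the equation between the computed derivative and the announced one. *)
Ltac derive_with := lazymatch goal with
  |- is_derive ?x ?v ?f ?df =>
    eapply (@eq_ind _ _ (fun d => is_derive x v f d)); [der|cbv beta] end.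

(** * Roots of the one-dimensional Robin equations *)

Section Roots.
Variable R : realType.
Implicit Types (h s k a : R) (j : nat).

(** The distance that the angles below keep from [0] and [pi / 2]. Its value makes
    the frequencies differ by less than [1 / 8] from their limits [1, 2, 3], and lets
    [7 / 2 * (pi / 4) + 2 * margin] equal [pi], see [riccati_piece]. *)
Definition margin : R := pi / 16.

(** Four times [cot margin]: frequencies are below [3], so this is enough for
    [robin_angle_lt_margin], and it exceeds [7 / 2 * cot margin], the boundary value
    of the Riccati solutions. *)
Definition h_threshold : R := 4 * cos margin / sin margin.

(** With [s = (j + 1) pi / 2 - alpha / 2] the equations for the even modes and for
    the odd mode take the same form. *)
Definition robin_angle j h s : Prop :=
  0 < s < pi / 2 /\ (j.+1%:R - s / (pi / 2)) * cos s = h * sin s.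

Lemma pihalf_gt0 : 0 < pi / 2 :> R.
Proof. by have := pi_gt0 R; lra. Qed.

Lemma margin_gt0 : 0 < margin.
Proof. have := pi_gt0 R; rewrite /margin; lra. Qed.

Lemma margin_lt_pihalf : margin < pi / 2.
Proof. have := pi_gt0 R; rewrite /margin; lra. Qed.

Lemma sin_margin_gt0 : 0 < sin margin.
Proof. by apply: sin_gt0_pihalf; rewrite margin_gt0 margin_lt_pihalf. Qed.

Lemma cos_margin_gt0 : 0 < cos margin.
Proof. by apply: cos_gt0_pihalf; rewrite margin_lt_pihalf andbT; have := margin_gt0; have := margin_lt_pihalf; lra. Qed.

Lemma h_threshold_gt0 : 0 < h_threshold.
Proof. by rewrite /h_threshold divr_gt0 ?mulr_gt0 ?sin_margin_gt0 ?cos_margin_gt0. Qed.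

Lemma lt_h_thresholdP h : h_threshold < h -> 4 * cos margin < h * sin margin.
Proof. by rewrite /h_threshold ltr_pdivrMr // sin_margin_gt0. Qed.

Lemma cos_le_pihalf (x y : R) : 0 <= x -> x <= y -> y <= pi / 2 -> cos y <= cos x.
Proof.
move=> x0 xy yp; rewrite le_eqVlt; case: (eqVneq x y) => [->|nxy]; first by rewrite eqxx.
have pp := pi_gt0 R.
by rewrite ltr_cos ?in_itv /= ?lt_neqAle ?nxy ?xy ?orbT //; lra.
Qed.

Lemma sin_le_pihalf (x y : R) : 0 <= x -> x <= y -> y <= pi / 2 -> sin x <= sin y.
Proof.
move=> x0 xy yp; rewrite le_eqVlt; case: (eqVneq x y) => [->|nxy]; first by rewrite eqxx.
have pp := pi_gt0 R.
by rewrite ltr_sin ?in_itv /= ?lt_neqAle ?nxy ?xy ?orbT //; lra.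
Qed.

Lemma robin_angle_exists j h : 0 < h -> exists s, robin_angle j h s.
Proof.
move=> h0; pose f s := (j.+1%:R - s / (pi / 2)) * cos s - h * sin s.
have pp := pi_gt0 R.
have cf : {within `[0, pi / 2], continuous f}.
  apply: continuous_subspaceT; rewrite /f; cont.
have f0 : f 0 = j.+1%:R by rewrite /f cos0 sin0 mul0r subr0 mulr1 mulr0 subr0.
have f1 : f (pi / 2) = - h by rewrite /f cos_pihalf sin_pihalf mulr0 mulr1 sub0r.
have j0 : 0 < j.+1%:R :> R by rewrite ltr0n.
have := @IVT R f 0 (pi / 2) 0; rewrite f0 f1.
case=> //; first lra.
  by rewrite ge_min le_max; apply/andP; split; apply/orP; [right|left]; lra.
move=> s; rewrite in_itv /= => /andP[s0 s1] fs0; exists s; split; last first.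
  by move: fs0; rewrite /f; lra.
rewrite !lt_neqAle s0 s1 !andbT; apply/andP; split.
  by apply/negP => /eqP e; rewrite -e f0 in fs0; lra.
by apply/negP => /eqP e; rewrite e f1 in fs0; lra.
Qed.

(** An angle above the margin has [cot s <= cot margin], too small for [h]. *)
Lemma robin_angle_lt_margin j h s : (j <= 2)%N -> h_threshold < h ->
  robin_angle j h s -> s < margin.
Proof.
move=> j2 /lt_h_thresholdP hh [/andP[s0 s1] e].
rewrite ltNge; apply/negP => ms.
have pp := pi_gt0 R.
have c := cos_le_pihalf (ltW margin_gt0) ms (ltW s1).
have sn := sin_le_pihalf (ltW margin_gt0) ms (ltW s1).
have hs0 := sin_margin_gt0; have cs0 := cos_margin_gt0.
have c0 : 0 < cos s by apply: cos_gt0_pihalf; lra.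
have h0 : 0 < h by rewrite -(pmulr_lgt0 _ hs0); lra.
have : (j.+1%:R - s / (pi / 2)) * cos s <= 3 * cos s.
  rewrite ler_pM2r //; have : 0 < s / (pi / 2) by rewrite divr_gt0 //; lra.
  have : j.+1%:R <= 3 :> R by rewrite ler_nat.
  lra.
have : h * sin margin <= h * sin s by rewrite ler_pM2l.
lra.
Qed.

Lemma tan_robin_angle s : tan (pi / 2 - s) = cos s / sin s.
Proof.
by rewrite /tan sinB cosB sin_pihalf cos_pihalf !mul1r !mul0r subr0 add0r.
Qed.

(** [alpha p h] is a totalised choice, so the root of [robin_angle_exists] is
    needed to know that the chosen value satisfies the equation. *)
Lemma alpha_robin_angle p h : p = 0%N \/ p = 2%N -> 0 < h ->
  exists2 s, robin_angle p h s & alpha p h = p.+1%:R * pi - 2 * s.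
Proof.
move=> p02 h0; have pp := pi_gt0 R.
have pn0 : pi != 0 :> R by rewrite gt_eqF.
have tp s : tan ((p.+1%:R * pi - 2 * s) / 2) = cos s / sin s.
  case: p02 => -> {p}; rewrite -tan_robin_angle.
    by congr tan; lra.
  by rewrite -[RHS]tanDpi; congr tan; lra.
clear p02.
have key s : 0 < s < pi / 2 ->
   ((p.+1%:R * pi - 2 * s) * tan ((p.+1%:R * pi - 2 * s) / 2) = h * pi <->
   (p.+1%:R - s / (pi / 2)) * cos s = h * sin s).
  move=> hs; have sn : sin s != 0 by rewrite gt_eqF // sin_gt0_pihalf.
  rewrite tp.
  have e1 (P K C S : R) : P != 0 -> S != 0 ->
      (K * P - 2 * s) * (C / S) = P * ((K - s / (P / 2)) * C) / S.
    by move=> P0 S0; field; rewrite P0 S0.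
  rewrite e1 //; split=> [|->]; last by rewrite mulrA mulfK // mulrC.
  move/(congr1 ( *%R^~ (sin s))); rewrite /= divfK // => e.
  by apply: (mulfI pn0); rewrite e mulrA (mulrC pi).
have [s [hs es]] := @robin_angle_exists p h h0.
have : [set a | p%:R * pi <= a < p.+1%:R * pi /\ a * tan (a / 2) = h * pi] !=set0.
  exists (p.+1%:R * pi - 2 * s); split; last exact/key.
  by rewrite -[p.+1]addn1 natrD; lra.
move=> /getPex; rewrite -/(alpha p h) => -[ha ea].
have hs' : 0 < p.+1%:R * pi / 2 - alpha p h / 2 <= pi / 2.
  by move: ha; rewrite -[p.+1]addn1 natrD; lra.
exists (p.+1%:R * pi / 2 - alpha p h / 2); last by lra.
have lt : p.+1%:R * pi / 2 - alpha p h / 2 < pi / 2.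
  rewrite lt_neqAle; case/andP: hs' => _ ->; rewrite andbT; apply/negP => /eqP e.
  move: ea; have -> : alpha p h = p.+1%:R * pi - 2 * (pi / 2) by lra.
  by rewrite tp cos_pihalf mul0r mulr0; move: (mulr_gt0 h0 pp); lra.
split; first by lra.
apply/key; first by lra.
have -> : p.+1%:R * pi - 2 * (p.+1%:R * pi / 2 - alpha p h / 2) = alpha p h by lra.
exact: ea.
Qed.

End Roots.

(** * Connected components and polygonal paths *)

Section NodalTopology.
Variable R : realType.
Implicit Types (u v : R * R -> R) (A C : set (R * R)) (x y : R) (p q : R * R).

(** Two points are linked in [C] by [connected_component C]; this relation is
    transitive, so a polygonal path is a chain of axis-parallel segments. *)
Lemma linked_horizontal C x1 x2 y :
  (forall x, (x1 <= x <= x2) || (x2 <= x <= x1) -> C (x, y)) ->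
  connected_component C (x1, y) (x2, y).
Proof.
wlog le12 : x1 x2 / x1 <= x2 => [wl hC|hC].
  have [le12|/ltW le21] := leP x1 x2; first exact: wl.
  by apply/connected_component_sym/wl => // x; rewrite orbC; exact: hC.
exists ((fun x => (x, y)) @` `[x1, x2]); last first.
  by exists x2 => //=; rewrite in_itv /= le12 lexx.
split.
- by exists x1 => //=; rewrite in_itv /= le12 lexx.
- by move=> _ [x xx <-]; apply: hC; move: xx; rewrite /= in_itv /= => ->.
- apply: connected_continuous_connected; first exact: segment_connected.
  by apply: continuous_subspaceT; cont.
Qed.

Lemma linked_vertical C x y1 y2 :
  (forall y, (y1 <= y <= y2) || (y2 <= y <= y1) -> C (x, y)) ->
  connected_component C (x, y1) (x, y2).
Proof.
wlog le12 : y1 y2 / y1 <= y2 => [wl hC|hC].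
  have [le12|/ltW le21] := leP y1 y2; first exact: wl.
  by apply/connected_component_sym/wl => // y; rewrite orbC; exact: hC.
exists ((fun y => (x, y)) @` `[y1, y2]); last first.
  by exists y2 => //=; rewrite in_itv /= le12 lexx.
split.
- by exists y1 => //=; rewrite in_itv /= le12 lexx.
- by move=> _ [y yy <-]; apply: hC; move: yy; rewrite /= in_itv /= => ->.
- apply: connected_continuous_connected; first exact: segment_connected.
  by apply: continuous_subspaceT; cont.
Qed.

Lemma connected_linked C p : C p ->
  (forall q, C q -> connected_component C p q) -> connected C.
Proof.
move=> Cp hC; suff -> : C = connected_component C p by exact: component_connected.
by apply/seteqP; split => [q /hC//|]; exact: connected_component_sub.
Qed.

(** A certificate for the connected components of [A]: connectedness alone would
    only bound their number from above, openness makes each piece clopen in [A]. *)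
Definition open_pieces A n (D : nat -> set (R * R)) : Prop :=
  [/\ forall i, (i < n)%N -> [/\ open (D i), connected (D i) & D i !=set0],
      forall i j p, (i < n)%N -> (j < n)%N -> D i p -> D j p -> i = j
    & forall p, A p <-> exists2 i, (i < n)%N & D i p].

(** A connected subset of [A] meeting [D i] is contained in it, since the union of
    the other pieces is open as well. *)
Lemma open_pieces_component A n D i p : open_pieces A n D -> (i < n)%N ->
  D i p -> connected_component A p = D i.
Proof.
move=> [hD dD hA] ni Dip; apply/seteqP; split; last first.
  have [_ cD _] := hD i ni.
  apply: connected_component_max => // q Dq; apply/hA; by exists i.
move=> q [C [Cp CA cC Cq]].
pose rest := \bigcup_(j in [set j | (j < n)%N /\ j <> i]) D j.
have orest : open rest by apply: bigcup_open => j [nj _]; have [] := hD j nj.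
suff e : C `&` D i = C by move: Cq; rewrite -e => -[].
apply: cC; first by exists p.
  by exists (D i) => //; have [] := hD i ni.
exists (~` rest); first exact: open_closedC.
apply/seteqP; split => r [Cr hr]; split=> //.
  by move=> [j [nj ji] Djr]; apply: ji; apply: dD Djr hr.
have /hA[j nj Djr] := CA r Cr.
have [->//|ji] := pselect (i = j).
by exfalso; apply: hr; exists j => //; split => // e; apply: ji.
Qed.

Lemma open_pieces_nodal_domains u n D :
  open_pieces (square (R:=R) `\` u @^-1` [set 0]) n D -> has_nodal_domains u n.
Proof.
move=> hD; have [h1 h2 h3] := hD.
suff e : nodal_domains u = D @` `I_n.
  rewrite /has_nodal_domains e; apply: inj_card_eq => i j /set_mem /= ni /set_mem /= nj eD.
  have [_ _ [p Dp]] := h1 i ni.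
  by apply: (h2 i j p) => //; rewrite -eD.
rewrite /nodal_domains; apply/seteqP; split.
  move=> _ [p Ap <-]; have /h3[i ni Dip] := Ap.
  by exists i => //; rewrite (open_pieces_component hD ni Dip).
move=> _ [i ni <-]; have [_ _ [p Dp]] := h1 i ni.
exists p; last exact: open_pieces_component hD ni Dp.
by apply/h3; exists i.
Qed.

Lemma has_nodal_domains_eq u v n :
  (forall p, square p -> (u p == 0) = (v p == 0)) ->
  has_nodal_domains u n -> has_nodal_domains v n.
Proof.
move=> e; suff sE : square (R:=R) `\` u @^-1` [set 0] = square (R:=R) `\` v @^-1` [set 0].
  by rewrite /has_nodal_domains /nodal_domains sE.
apply/seteqP; split => p [sp np]; split => // /eqP vp; apply: np => /=; apply/eqP.
  by rewrite e.
by rewrite -e.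
Qed.

Lemma square_normP p : square p <-> `|p.1| < pi / 2 /\ `|p.2| < pi / 2.
Proof. by rewrite /square /= !ltr_norml; split => [/andP[]|[-> ->]]. Qed.

Lemma open_gt0 (f : R * R -> R) : continuous f -> open [set p | 0 < f p].
Proof.
move=> cf; have -> : [set p | 0 < f p] = f @^-1` [set x | x > 0] by [].
by apply: open_comp; [move=> p _; exact: cf|exact: open_gt].
Qed.

Lemma open_square : open (square (R:=R)).
Proof.
have -> : square (R:=R) = [set p : R * R | 0 < pi / 2 - `|p.1|] `&` [set p | 0 < pi / 2 - `|p.2|].
  by apply/seteqP; split => p; rewrite square_normP /= !subr_gt0.
by apply: openI; apply: open_gt0; cont.
Qed.

End NodalTopology.

(** * Nodal domains of sums of decreasing functions *)

Section NodalCounts.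
Variable R : realType.
Implicit Types (c x y t : R) (p : R * R).
Variables (b : R) (A B : R -> R).
Hypothesis b_half_pi : b = pi / 2.
Hypotheses (cA : continuous A) (cB : continuous B).
Hypothesis A_gt0 : forall x, `|x| <= b -> 0 < A x.
Hypotheses (A_even : forall x, A (- x) = A x) (B_even : forall x, B (- x) = B x).
Let r x := B x / A x.
Hypothesis r0 : r 0 = 1.
Hypothesis r_decr : forall x y, 0 <= x -> x < y -> y <= b -> r y < r x.
Let q := r b.
Hypothesis q_lt : q < -1.

Definition nodal_family c p := A p.1 * B p.2 + c * (B p.1 * A p.2).

Fact b_gt0 : 0 < b. Proof. by rewrite b_half_pi pihalf_gt0. Qed.

Fact r_norm x : r `|x| = r x.
Proof. by rewrite /r; case: (ger0P x) => // _; rewrite A_even B_even. Qed.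

Fact r_le x y : `|x| <= `|y| -> `|y| <= b -> r y <= r x.
Proof.
move=> xy yb; rewrite -(r_norm x) -(r_norm y).
case: (eqVneq `|x| `|y|) => [->//|nxy].
by apply/ltW/r_decr => //; rewrite lt_neqAle nxy.
Qed.

Fact r_le1 x : `|x| <= b -> r x <= 1.
Proof. by move=> xb; rewrite -r0; apply: r_le => //; rewrite normr0. Qed.

Fact r_gtq x : `|x| < b -> q < r x.
Proof. by move=> xb; rewrite -r_norm; apply: r_decr. Qed.

Lemma squareP p : square p <-> `|p.1| < b /\ `|p.2| < b.
Proof. by rewrite b_half_pi; exact: square_normP. Qed.

(** Dividing by the positive factor [A x * A y] turns the two-variable family
    into a sum of one-variable monotone functions. *)
Lemma nodal_familyE c p : square p ->
  nodal_family c p = A p.1 * A p.2 * (r p.2 + c * r p.1).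
Proof.
move=> /squareP[/ltW/A_gt0 x0 /ltW/A_gt0 y0]; rewrite /nodal_family /r.
by field; rewrite !gt_eqF.
Qed.

Lemma nodal_family_gt0 c p : square p -> (0 < nodal_family c p) = (0 < r p.2 + c * r p.1).
Proof.
move=> sp; rewrite nodal_familyE //; case/squareP : sp => /ltW/A_gt0 x0 /ltW/A_gt0 y0.
by rewrite pmulr_rgt0 // mulr_gt0.
Qed.

Lemma nodal_family_lt0 c p : square p -> (nodal_family c p < 0) = (r p.2 + c * r p.1 < 0).
Proof.
move=> sp; rewrite nodal_familyE //; case/squareP : sp => /ltW/A_gt0 x0 /ltW/A_gt0 y0.
by rewrite pmulr_rlt0 // mulr_gt0.
Qed.

Lemma nodal_family_continuous c : continuous (nodal_family c).
Proof.
rewrite /nodal_family.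
have c1 f : continuous f -> continuous (fun p : R * R => f p.1 : R).
  by move=> cf; apply: cont_comp => //; cont.
have c2 f : continuous f -> continuous (fun p : R * R => f p.2 : R).
  by move=> cf; apply: cont_comp => //; cont.
by cont; (apply: c1 || apply: c2).
Qed.

Lemma near_side v : q < v -> exists2 t, 0 < t < b & r t < v.
Proof.
have b0 := b_gt0.
move=> qv.
have cr : {for b, continuous r}.
  apply: cvgM; first exact: cB.
  by apply: cvgV; [rewrite gt_eqF // A_gt0 // gtr0_norm|exact: cA].
have hn := cvgr_lt (r b) cr v qv.
have /nbhs_ballP[e /= e0 he] : \forall t \near b, r t < v by exact: hn.
pose d := Num.min (e / 2) (b / 2).
have d0 : 0 < d by rewrite lt_min !divr_gt0.
have [de db] : d <= e / 2 /\ d <= b / 2 by rewrite !ge_min !lexx orbT.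
exists (b - d); first lra.
by apply: he; rewrite /ball /= opprB addrC subrK gtr0_norm; lra.
Qed.

Fact sq_pair x y : `|x| < b -> `|y| < b -> square (x, y).
Proof. by move=> xb yb; apply/squareP. Qed.

Fact norm_itv0 x t : (x <= t <= 0) || (0 <= t <= x) -> `|t| <= `|x|.
Proof.
by case/orP => /andP[h1 h2]; [rewrite !ler0_norm|rewrite !ger0_norm]; lra.
Qed.

(** The bounds on [c] say that [- c * r x] always lies strictly between [q] and [1], the
    extreme values of [r]: on each vertical line the function is positive on the axis
    and negative near both ends, and monotone in between. *)
Lemma three_domains c : -1 < c -> c * q >= -1 -> has_nodal_domains (nodal_family c) 3.
Proof.
have b0 := b_gt0.
move=> c1 cq.
have cr_gt x : `|x| < b -> -1 < c * r x.
  move=> xb; have := r_gtq xb; have := r_le1 (ltW xb); move: (r x) => s s1 sq.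
  have [c0|c0|c0] := ltgtP 0 c; [| |by rewrite -c0; lra]; nra.
have cr_le x : `|x| < b -> c * r x <= Num.max c (c * q).
  move=> xb; have := r_gtq xb; have := r_le1 (ltW xb); move: (r x) => s s1 sq.
  by rewrite le_max; apply/orP; have [c0|c0] := leP 0 c; [left|right]; nra.
(* A height [y1] above which the function is negative for all [x] at once. *)
have [y1 hy1 ry1] : exists2 t, 0 < t < b & r t < - Num.max c (c * q).
  apply: near_side; rewrite ltrNr gt_max; move: q q_lt cq => Q Q1 cQ.
  have c2 : 0 < (c + 1) * (- Q) by apply: mulr_gt0; lra.
  apply/andP; split; last by lra.
  rewrite ltNge; apply/negP => Qc.
  have : 0 <= (c + Q) * (-1 - Q) by apply: mulr_ge0; lra.
  have : 0 < (- 1 - Q) * (1 - Q) by apply: mulr_gt0; lra.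
  nra.
(* The pieces 1 and 2 are the upper and the lower negative domain. *)
pose s (i : nat) : R := if i == 1%N then 1 else -1.
have s_norm i : `|s i| = 1 by rewrite /s; case: ifP; rewrite ?normrN normr1.
pose D (i : nat) : set (R * R) := if i == 0%N
  then [set p | square p /\ 0 < nodal_family c p]
  else [set p | square p /\ (nodal_family c p < 0 /\ 0 < s i * p.2)].
have Dpos : open (D 0%N) /\ connected (D 0%N) /\ D 0%N (0, 0).
  have D00 x : `|x| < b -> D 0%N (x, 0).
    move=> xb; have sp : square (x, 0) by apply: sq_pair; rewrite ?normr0.
    by split => //; rewrite nodal_family_gt0 //= r0; have := cr_gt x xb; lra.
  split; first by apply: openI; [exact: open_square|exact/open_gt0/nodal_family_continuous].
  split; last by apply: D00; rewrite normr0.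
  apply: (@connected_linked _ _ (0, 0)); first by apply: D00; rewrite normr0.
  move=> [x y] [sp fp]; have [/= xb yb] := (squareP (x, y)).1 sp.
  apply: connected_component_sym.
  apply: (@connected_component_trans _ _ (x, 0)); last first.
    by apply: linked_horizontal => t /norm_itv0 tx; apply: D00; exact: le_lt_trans xb.
  apply: linked_vertical => t /norm_itv0 ty.
  have sp' : square (x, t) by apply: sq_pair => //; exact: le_lt_trans yb.
  split => //; rewrite nodal_family_gt0 //; move: fp; rewrite nodal_family_gt0 //= => fp.
  by apply: lt_le_trans fp _; rewrite lerD2r r_le // ltW.
have Dneg i : i <> 0%N -> open (D i) /\ connected (D i) /\ D i (0, s i * y1).
  move=> /eqP/negbTE i0; have DE : D i = [set p | square p /\ (nodal_family c p < 0 /\ 0 < s i * p.2)].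
    by rewrite /D i0.
  have ss : s i * s i = 1 by rewrite /s; case: ifP; lra.
  have ny y : 0 < s i * y -> `|y| = s i * y.
    by move=> y0; rewrite -[LHS]mul1r -(s_norm i) -normrM gtr0_norm.
  have Dy1 x : `|x| < b -> D i (x, s i * y1).
    move=> xb; have n1 : `|s i * y1| = y1 by rewrite normrM s_norm mul1r gtr0_norm //; lra.
    have sp : square (x, s i * y1) by apply: sq_pair; rewrite ?n1 //; lra.
    rewrite DE; split => //; rewrite /= mulrA ss mul1r; split; last by lra.
    by rewrite nodal_family_lt0 //= -r_norm n1; have := cr_le x xb; lra.
  split.
    rewrite DE; apply: openI; first exact: open_square.
    apply: openI; last by apply: open_gt0; cont.
    rewrite (_ : (fun p => nodal_family c p < 0 : Prop) = [set p | 0 < - nodal_family c p]).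
      by apply: open_gt0; cont; exact: nodal_family_continuous.
    by apply/funext => p /=; rewrite oppr_gt0.
  split; last by apply: Dy1; rewrite normr0.
  apply: (@connected_linked _ _ (0, s i * y1)); first by apply: Dy1; rewrite normr0.
  move=> [x y]; rewrite DE => -[sp [fp /= sy]]; have [/= xb yb] := (squareP (x, y)).1 sp.
  rewrite -DE; apply: connected_component_sym.
  apply: (@connected_component_trans _ _ (x, s i * y1)); last first.
    by apply: linked_horizontal => t /norm_itv0 tx; apply: Dy1; exact: le_lt_trans xb.
  apply: linked_vertical => t ht.
  have st : (s i * y <= s i * t <= y1) \/ (y1 <= s i * t <= s i * y).
    by move: ht ss; rewrite /s; case: ifP => _ /orP[]/andP[h1 h2] _; [left|right|right|left]; lra.
  have st0 : 0 < s i * t by case: st => /andP[h1 h2]; lra.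
  have tb : `|t| < b by rewrite ny //; move: yb; rewrite ny //; case: st => /andP[h1 h2]; lra.
  have sp' : square (x, t) by exact: sq_pair.
  rewrite DE; split => //=; split => //; rewrite nodal_family_lt0 //=.
  case: st => /andP[h1 h2].
    move: fp; rewrite nodal_family_lt0 //=; apply: le_lt_trans; rewrite lerD2r r_le ?ny //.
    by rewrite -ny // ltW.
  have := cr_le x xb; suff : r t <= r y1 by lra.
  apply: r_le; last by rewrite ltW.
  by rewrite gtr0_norm ?ny //; lra.
apply: (@open_pieces_nodal_domains _ _ _ D); split.
- case=> [|i] ni; first by case: Dpos => h1 [h2 h3]; split => //; exists (0, 0).
  have [h1 [h2 h3]] := Dneg i.+1 (fun e => notF (congr1 (fun k => k == 0%N) e)).
  by split => //; exists (0, s i.+1 * y1).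
- case=> [|[|[|//]]] [|[|[|//]]] p _ _ //=; rewrite /D /s /=.
  + by move=> [_ h1] [_ [h2 _]]; exfalso; lra.
  + by move=> [_ h1] [_ [h2 _]]; exfalso; lra.
  + by move=> [_ [h2 _]] [_ h1]; exfalso; lra.
  + by move=> [_ [_ h1]] [_ [_ h2]]; exfalso; lra.
  + by move=> [_ [h2 _]] [_ h1]; exfalso; lra.
  + by move=> [_ [_ h1]] [_ [_ h2]]; exfalso; lra.
- move=> p; split; last first.
    case=> -[|[|[|//]]] _; rewrite /D /=.
    + by move=> [sp h]; split => //= e; move: h; rewrite e ltxx.
    + by move=> [sp [h _]]; split => //= e; move: h; rewrite e ltxx.
    + by move=> [sp [h _]]; split => //= e; move: h; rewrite e ltxx.
  move=> [sp /eqP fp]; have [f0|f0|e] := ltgtP 0 (nodal_family c p).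
  + by exists 0%N.
  + have [/= xb yb] := (squareP p).1 sp.
    have [y0|y0|y0] := ltgtP 0 p.2.
    * by exists 1%N => //; rewrite /D /s /=; split => //; split => //; lra.
    * by exists 2%N => //; rewrite /D /s /=; split => //; split => //; lra.
    * by move: f0; rewrite nodal_family_lt0 // -y0 r0; have := cr_gt _ xb; lra.
  + by rewrite -e eqxx in fp.
Qed.

(** Both inequalities with [q] say that the function is negative along all four sides,
    so the negative points reach a connected frame by moving outwards, and the
    positive points reach the centre by moving inwards. *)
Lemma two_domains c : 0 < c -> c * q < -1 -> c + q < 0 -> has_nodal_domains (nodal_family c) 2.
Proof.
have b0 := b_gt0.
move=> c0 cq1 cq2.
have [d hd rd] : exists2 t, 0 < t < b & r t < Num.min (- c) (- c^-1).
  apply: near_side; rewrite lt_min; apply/andP; split; first lra.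
  by rewrite -(ltr_pM2l c0) mulrN mulfV ?gt_eqF.
move: rd; rewrite lt_min => /andP[rd1 rd2].
have {}rd2 : c * r d < -1 by rewrite -(ltr_pM2l c0) mulrN mulfV ?gt_eqF // in rd2.
have db : `|d| = d by rewrite gtr0_norm; lra.
(* [far1] and [far2] put the frame [d <= max (|x|, |y|)] in the negative set. *)
have far1 x y : `|x| < b -> `|y| < b -> d <= `|x| -> r y + c * r x < 0.
  move=> xb yb dx; have := r_le1 (ltW yb).
  have : r x <= r d by apply: r_le; rewrite ?db // ltW.
  nra.
have far2 x y : `|x| < b -> `|y| < b -> d <= `|y| -> r y + c * r x < 0.
  move=> xb yb dx; have := r_le1 (ltW xb).
  have : r y <= r d by apply: r_le; rewrite ?db // ltW.
  nra.
pose D (i : nat) : set (R * R) := if i == 0%N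
  then [set p | square p /\ 0 < nodal_family c p]
  else [set p | square p /\ nodal_family c p < 0].
have Dpos : open (D 0%N) /\ connected (D 0%N) /\ D 0%N (0, 0).
  have D00 : D 0%N (0, 0).
    have sp : square (0 : R, 0 : R) by apply: sq_pair; rewrite normr0.
    by split => //; rewrite nodal_family_gt0 //= r0; lra.
  split; first by apply: openI; [exact: open_square|exact/open_gt0/nodal_family_continuous].
  split => //; apply: (connected_linked D00).
  move=> [x y] [sp fp]; have [/= xb yb] := (squareP (x, y)).1 sp.
  move: fp; rewrite nodal_family_gt0 //= => fp.
  have down s t : `|s| <= `|x| -> `|t| <= `|y| -> D 0%N (s, t).
    move=> sx ty; have sp' : square (s, t) by apply: sq_pair; [exact: le_lt_trans xb|exact: le_lt_trans yb].
    split => //; rewrite nodal_family_gt0 //=; apply: lt_le_trans fp _.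
    by apply: lerD; rewrite ?ler_pM2l //; apply: r_le => //; rewrite ltW.
  apply: connected_component_sym.
  apply: (@connected_component_trans _ _ (x, 0)).
    by apply: linked_vertical => t /norm_itv0 ty; apply: down.
  by apply: linked_horizontal => t /norm_itv0 tx; apply: down; rewrite ?normr0.
have Dneg : open (D 1%N) /\ connected (D 1%N) /\ D 1%N (0, d).
  have neg x y : `|x| < b -> `|y| < b -> r y + c * r x < 0 -> D 1%N (x, y).
    move=> xb yb h; have sp : square (x, y) by exact: sq_pair.
    by split => //; rewrite nodal_family_lt0.
  have D0d : D 1%N (0, d) by apply: neg; rewrite ?normr0 ?db //; [lra|apply: far2; rewrite ?normr0 ?db //; lra].
  split.
    apply: openI; first exact: open_square.
    rewrite (_ : (fun p => nodal_family c p < 0 : Prop) = [set p | 0 < - nodal_family c p]).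
      by apply: open_gt0; cont; exact: nodal_family_continuous.
    by apply/funext => p /=; rewrite oppr_gt0.
  split => //; apply: (connected_linked D0d).
  move=> [x y] [sp fp]; have [/= xb yb] := (squareP (x, y)).1 sp.
  move: fp; rewrite nodal_family_lt0 //= => fp.
  have [x' x'b [dx' hx']] : exists2 x', `|x'| < b &
      d <= `|x'| /\ forall t, (x <= t <= x') || (x' <= t <= x) -> `|t| < b /\ `|x| <= `|t|.
    have [dx|dx] := leP d `|x|.
      exists x => //; split => // t; rewrite orbb => /andP[h1 h2].
      by have -> : t = x by apply/le_anti; rewrite h1 h2.
    have [x0|x0] := leP 0 x.
      exists d; first by lra.
      rewrite db; split => // t; move: dx xb; rewrite ger0_norm // => dx xb ht.
      by have t0 : 0 <= t; [|rewrite ger0_norm //]; case/orP : ht => /andP[h1 h2]; lra.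
    exists (- d); first by rewrite normrN; lra.
    rewrite normrN db; split => // t; move: dx xb; rewrite ltr0_norm // => dx xb ht.
    by have t0 : t <= 0; [|rewrite ler0_norm //]; case/orP : ht => /andP[h1 h2]; lra.
  apply: connected_component_sym.
  apply: (@connected_component_trans _ _ (x', y)).
    apply: linked_horizontal => t /hx'[tb xt]; apply: neg => //.
    apply: le_lt_trans fp; rewrite lerD2l ler_pM2l //; exact/r_le/ltW.
  apply: (@connected_component_trans _ _ (x', d)).
    apply: linked_vertical => t ht; apply: neg => //; last first.
      apply: far1 => //; rewrite ltr_norml; move: yb; rewrite ltr_norml.
      by case/orP : ht => /andP[h1 h2]; lra.
    rewrite ltr_norml; move: yb; rewrite ltr_norml.
    by case/orP : ht => /andP[h1 h2]; lra.
  apply: linked_horizontal => t /norm_itv0 tx.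
  have tb : `|t| < b by exact: le_lt_trans x'b.
  by apply: neg => //; [rewrite db; lra|apply: far2; rewrite ?db //; lra].
apply: (@open_pieces_nodal_domains _ _ _ D); split.
- case=> [|[|//]] _; first by case: Dpos => h1 [h2 h3]; split => //; exists (0, 0).
  by case: Dneg => h1 [h2 h3]; split => //; exists (0, d).
- case=> [|[|//]] [|[|//]] p _ _ //=; rewrite /D /=.
  + by move=> [_ h1] [_ h2]; exfalso; lra.
  + by move=> [_ h2] [_ h1]; exfalso; lra.
- move=> p; split; last first.
    case=> -[|[|//]] _; rewrite /D /=.
    + by move=> [sp h]; split => //= e; move: h; rewrite e ltxx.
    + by move=> [sp h]; split => //= e; move: h; rewrite e ltxx.
  move=> [sp /eqP fp]; have [f0|f0|e] := ltgtP 0 (nodal_family c p).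
  + by exists 0%N.
  + by exists 1%N.
  + by rewrite -e eqxx in fp.
Qed.

(** [r] is even and injective on the half side, so [r y - r x] vanishes exactly on the
    diagonals. *)
Lemma four_domains : has_nodal_domains (nodal_family (-1)) 4.
Proof.
have b0 := b_gt0.
have fE p : square p -> (nodal_family (-1) p == 0) = (`|p.1| == `|p.2|).
  move=> sp; rewrite nodal_familyE //; have [/ltW xb /ltW yb] := (squareP p).1 sp.
  rewrite mulf_eq0 gt_eqF /=; last by rewrite mulr_gt0 ?A_gt0.
  rewrite mulN1r subr_eq0 -(r_norm p.1) -(r_norm p.2).
  have [h|h|->] := ltgtP `|p.1| `|p.2|; last by rewrite eqxx.
    by rewrite lt_eqF // r_decr.
  by rewrite gt_eqF // r_decr.
(* The pieces 0, 1 are the right and left triangles, 2, 3 the top and bottom ones. *)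
pose s (i : nat) : R := if odd i then -1 else 1.
have ss i : s i * s i = 1 by rewrite /s; case: ifP; lra.
pose D (i : nat) : set (R * R) := if (i < 2)%N
  then [set p | square p /\ 0 < s i * p.1 - `|p.2|]
  else [set p | square p /\ 0 < s i * p.2 - `|p.1|].
have hb i : `|s i * (b / 2)| < b.
  rewrite normrM (_ : `|s i| = 1); last by rewrite /s; case: ifP; rewrite ?normrN normr1.
  by rewrite mul1r gtr0_norm; lra.
have oD i : open (D i).
  rewrite /D; case: ifP => _; apply: openI; try exact: open_square.
    by apply: open_gt0; cont.
  by apply: open_gt0; cont.
have between i x t : 0 < s i * x -> (x <= t <= s i * (b / 2)) || (s i * (b / 2) <= t <= x) ->
    0 < s i * t /\ (`|x| < b -> `|t| < b).
  by rewrite /s; case: ifP => _ x0 /orP[]/andP[h1 h2];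
    (split; [lra|rewrite !ltr_norml; lra]).
have cD i : connected (D i) /\ D i !=set0.
  rewrite /D; case: ifP => i2.
    set C := [set p | _].
    have hC x : `|x| < b -> 0 < s i * x -> C (x, 0).
      by move=> xb x0; split; [apply: sq_pair; rewrite ?normr0|rewrite /= normr0; lra].
    have C0 : C (s i * (b / 2), 0) by apply: hC => //; rewrite mulrA ss; lra.
    split; last by exists (s i * (b / 2), 0).
    apply: (connected_linked C0) => -[x y] [sp /= hp]; have [/= xb yb] := (squareP (x, y)).1 sp.
    have x0 : 0 < s i * x by have := normr_ge0 y; lra.
    apply: connected_component_sym; apply: (@connected_component_trans _ _ (x, 0)).
      apply: linked_vertical => t /norm_itv0 ty; split; last by rewrite /=; lra.
      by apply: sq_pair => //; exact: le_lt_trans yb.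
    by apply: linked_horizontal => t /(between _ _ _ x0)[t0 tb]; exact: hC (tb xb) t0.
  set C := [set p | _].
  have hC x : `|x| < b -> 0 < s i * x -> C (0, x).
    by move=> xb x0; split; [apply: sq_pair; rewrite ?normr0|rewrite /= normr0; lra].
  have C0 : C (0, s i * (b / 2)) by apply: hC => //; rewrite mulrA ss; lra.
  split; last by exists (0, s i * (b / 2)).
  apply: (connected_linked C0) => -[y x] [sp /= hp]; have [/= yb xb] := (squareP (y, x)).1 sp.
  have x0 : 0 < s i * x by have := normr_ge0 y; lra.
  apply: connected_component_sym; apply: (@connected_component_trans _ _ (0, x)).
    apply: linked_horizontal => t /norm_itv0 ty; split; last by rewrite /=; lra.
    by apply: sq_pair => //; exact: le_lt_trans yb.
  by apply: linked_vertical => t /(between _ _ _ x0)[t0 tb]; exact: hC (tb xb) t0.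
apply: (@open_pieces_nodal_domains _ _ _ D); split.
- by move=> i _; case: (cD i).
- move=> i j p; rewrite /D /s; have := ler_norm p.1; have := ler_norm p.2.
  have := ler_norm (- p.1); have := ler_norm (- p.2); rewrite !normrN.
  case: i j => [|[|[|[|//]]]] [|[|[|[|//]]]] //= h1 h2 h3 h4 _ _ [_ h5] [_ h6]; exfalso; lra.
- move=> p; split.
    move=> [sp /eqP]; rewrite fE // => np.
    have [h|h|e] := ltgtP `|p.1| `|p.2|; last by rewrite e eqxx in np.
      have [y0|y0] := leP 0 p.2.
        by exists 2%N => //; rewrite /D /s /=; split => //; rewrite (ger0_norm y0) in h; lra.
      by exists 3%N => //; rewrite /D /s /=; split => //; rewrite (ltr0_norm y0) in h; lra.
    have [y0|y0] := leP 0 p.1.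
      by exists 0%N => //; rewrite /D /s /=; split => //; rewrite (ger0_norm y0) in h; lra.
    by exists 1%N => //; rewrite /D /s /=; split => //; rewrite (ltr0_norm y0) in h; lra.
  have h4 := ler_norm p.1; have h3 := ler_norm p.2.
  have := ler_norm (- p.1); have := ler_norm (- p.2); rewrite !normrN => h2 h1.
  case=> i i4 Dp; have sp : square p by move: Dp; rewrite /D; case: ifP => _ [].
  split => // /eqP; rewrite fE // => /eqP e.
  by move: Dp; rewrite /D /s; case: i i4 => [|[|[|[|//]]]] _ /= [_ h5]; lra.
Qed.

End NodalCounts.

(** * Integrals of continuous functions over segments *)

Section SegmentIntegrals.
Variable R : realType.
Implicit Types (f g F : R -> R) (a b c d x y M eps : R).

(** Locked, so that arithmetic on integrals never unfolds the measure theory. *)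
Definition integ : R -> R -> (R -> R) -> R :=
  locked (fun a b f => \int[lebesgue_measure]_(x in `[a, b]) f x).

Lemma integE a b f : integ a b f = \int[lebesgue_measure]_(x in `[a, b]) f x.
Proof. by rewrite /integ -lock. Qed.

Lemma cont_within a b f : continuous f -> {within `[a, b], continuous f}.
Proof. exact: continuous_subspaceT. Qed.

Lemma segment_integrable a b f : {within `[a, b], continuous f} ->
  lebesgue_measure.-integrable `[a, b] (EFin \o f).
Proof. by move=> cf; apply: continuous_compact_integrable => //; exact: segment_compact. Qed.

Lemma eq_integ a b f g : (forall x, a <= x <= b -> f x = g x) ->
  integ a b f = integ a b g.
Proof. by move=> fg; rewrite !integE; apply: eq_Rintegral => x /set_mem /=; rewrite in_itv /=; exact: fg. Qed.

Lemma integD a b f g : {within `[a, b], continuous f} -> {within `[a, b], continuous g} ->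
  integ a b (fun x => f x + g x) = integ a b f + integ a b g.
Proof. by move=> cf cg; rewrite !integE; apply: RintegralD => //; exact: segment_integrable. Qed.

Lemma integB a b f g : {within `[a, b], continuous f} -> {within `[a, b], continuous g} ->
  integ a b (fun x => f x - g x) = integ a b f - integ a b g.
Proof. by move=> cf cg; rewrite !integE; apply: RintegralB => //; exact: segment_integrable. Qed.

Lemma integZ a b f c : {within `[a, b], continuous f} ->
  integ a b (fun x => c * f x) = c * integ a b f.
Proof. by move=> cf; rewrite !integE; apply: RintegralZl => //; exact: segment_integrable. Qed.

Lemma integ_ge0 a b f : (forall x, a <= x <= b -> 0 <= f x) -> 0 <= integ a b f.
Proof. by move=> f0; rewrite integE; apply: Rintegral_ge0 => x /=; rewrite in_itv /=; exact: f0. Qed.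

Lemma le_integ a b f g : {within `[a, b], continuous f} -> {within `[a, b], continuous g} ->
  (forall x, a <= x <= b -> f x <= g x) -> integ a b f <= integ a b g.
Proof.
by move=> cf cg fg; rewrite !integE; apply: le_Rintegral => //; exact: segment_integrable.
Qed.

Lemma integ_cst a b M : a <= b -> integ a b (fun=> M) = M * (b - a).
Proof.
move=> ab; rewrite integE Rintegral_cst //.
congr (_ * _); transitivity (fine (if (a < b)%R then b%:E - a%:E else 0)%E).
  congr fine; have := lebesgue_measure_itv `[a, b]; rewrite /= lte_fin; exact.
by case: ltgtP ab => //= -> _; rewrite subrr.
Qed.

Lemma norm_integ_le a b f M : a <= b -> {within `[a, b], continuous f} ->
  (forall x, a <= x <= b -> `|f x| <= M) -> `|integ a b f| <= M * (b - a).
Proof.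
move=> ab cf fM; rewrite integE; apply: le_trans (le_normr_Rintegral _ _) _ => //.
  exact: segment_integrable.
rewrite -(integ_cst M ab) -integE; apply: le_integ => //.
- by move=> x; apply: continuous_comp; [exact: cf|exact: norm_continuous].
- exact/cont_within/cont_cst.
Qed.

Lemma integ_split a c b f : a <= c -> c <= b -> {within `[a, b], continuous f} ->
  integ a b f = integ a c f + integ c b f.
Proof.
move=> ac cb cf; apply/eqP; rewrite addrC -subr_eq; apply/eqP.
have fi := segment_integrable cf.
rewrite !integE Rintegral_itvB ?bnd_simp //.
apply: Rintegral_itv_obnd_cbnd; apply: integrableS fi => //.
by move=> x /=; rewrite !in_itv /= => /andP[h ->]; rewrite andbT (le_trans ac) // ltW.
Qed.

Lemma integ_ftc a b f F : a < b -> {within `[a, b], continuous f} ->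
  {within `[a, b], continuous F} ->
  (forall x, a < x < b -> is_derive x 1 F (f x)) ->
  integ a b f = F b - F a.
Proof.
move=> ab cf cF dF; rewrite integE /Rintegral (@continuous_FTC2 _ f F) //.
- have /(continuous_within_itvP _ ab)[_ h2 h3] := cF.
  split=> // x; rewrite in_itv /= => /dF hx; exact: ex_derive.
- by move=> x; rewrite in_itv /= => /dF hx; rewrite derive1E; exact: derive_val.
Qed.

Lemma integ_eq0 a b f : continuous f -> (forall x, 0 <= f x) -> integ a b f = 0 ->
  forall x, a < x < b -> f x = 0.
Proof.
move=> cf f0 i0 x0 /andP[ax xb]; apply/eqP; rewrite eq_le f0 andbT leNgt; apply/negP => fx.
have hv : f x0 / 2 < f x0 by lra.
have hn := cvgr_gt (f x0) (cf x0) (f x0 / 2) hv.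
have /nbhs_ballP[e /= e0 he] : \forall t \near x0, f x0 / 2 < f t by exact: hn.
pose d := Num.min (e / 2) (Num.min (x0 - a) (b - x0)).
have d0 : 0 < d by rewrite !lt_min !subr_gt0 ax xb andbT divr_gt0.
have [de [da db]] : d <= e / 2 /\ d <= x0 - a /\ d <= b - x0.
  by rewrite /d !ge_min !lexx !orbT.
have cw u v : {within `[u, v], continuous f} by exact: cont_within.
have : integ (x0 - d) (x0 + d) (fun=> f x0 / 2) <= integ (x0 - d) (x0 + d) f.
  apply: le_integ => //; first exact/cont_within/cont_cst.
  move=> x hx; apply/ltW/he; rewrite /ball /= ltr_norml; lra.
rewrite integ_cst; last lra.
have p1 : 0 <= integ a (x0 - d) f by exact: integ_ge0.
have p2 : 0 <= integ (x0 + d) b f by exact: integ_ge0.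
have e1 : integ a b f = integ a (x0 - d) f + integ (x0 - d) b f by apply: integ_split => //; lra.
have e2 : integ (x0 - d) b f = integ (x0 - d) (x0 + d) f + integ (x0 + d) b f.
  by apply: integ_split => //; lra.
have : 0 < f x0 / 2 * (x0 + d - (x0 - d)) by apply: mulr_gt0; lra.
lra.
Qed.

(** By compactness, the neighbourhoods of [y0] given by continuity at the points
    [(x, y0)] contain a common one. *)
Lemma slice_uniform (f : R * R -> R) a b y0 eps : continuous f -> 0 < eps ->
  exists2 d, 0 < d & forall y, `|y - y0| < d ->
    forall x, a <= x <= b -> `|f (x, y) - f (x, y0)| <= eps.
Proof.
move=> cf e0.
have /compact_near_coveringP cK := @segment_compact R a b.
have : nbhs y0 [set y | `[a, b] `<=` (fun x => `|f (x, y) - f (x, y0)| <= eps)].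
  apply: (cK R (nbhs y0) (fun y x => `|f (x, y) - f (x, y0)| <= eps)) => x _.
  have e2 : 0 < eps / 2 by lra.
  have hx : \forall p \near (x, y0), `|f (x, y0) - f p| < eps / 2.
    by have /cvgrPdist_lt := cf (x, y0); apply.
  have [[A B] /= [A1 B1] AB] := hx.
  exists (A, B) => //= -[x' y'] /= [Ax' By'].
  have h1 : `|f (x, y0) - f (x', y')| < eps / 2 by exact: (AB (x', y')).
  have h2 : `|f (x, y0) - f (x', y0)| < eps / 2.
    by apply: (AB (x', y0)); split => //=; exact: nbhs_singleton.
  move: h1 h2; move: (f (x, y0)) (f (x', y')) (f (x', y0)) => u v w.
  by rewrite !ltr_norml ler_norml; lra.
move=> /nbhs_ballP[d /= d0 hd]; exists d => // y yd x xab.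
by apply: (hd y); [rewrite /ball /= distrC|rewrite /= in_itv].
Qed.

Lemma bounded_on_box (f : R * R -> R) a b c d :
  (forall x y, a <= x <= b -> c <= y <= d -> {for (x, y), continuous f}) ->
  exists2 M, 0 <= M & forall x y, a <= x <= b -> c <= y <= d -> `|f (x, y)| <= M.
Proof.
move=> cf.
have cK : compact (`[a, b] `*` `[c, d]) by apply: compact_setX; exact: segment_compact.
have : compact (f @` (`[a, b] `*` `[c, d])).
  apply: continuous_compact => //.
  apply: continuous_in_subspaceT => -[x y] /set_mem /= [].
  by rewrite /= !in_itv /=; exact: cf.
move=> /compact_bounded /ex_strict_bound_gt0 [M /ltW M0 hM]; exists M => // x y xab ycd.
by apply/ltW/hM; exists (x, y) => //=; rewrite !in_itv.
Qed.

End SegmentIntegrals.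

(** * Integrals depending on a parameter *)

Section ParametricIntegrals.
Variable R : realType.
Implicit Types (a b c d m x y z M eps : R).

(** The bound [M] on the derivative dominates the difference quotients. *)
Lemma integ_derive_param (f fy : R -> R -> R) a b y0 d M : 0 < d ->
  (forall x y, a <= x <= b -> `|y - y0| < d -> is_derive y 1 (f x) (fy x y)) ->
  (forall y, `|y - y0| < d -> {within `[a, b], continuous (f^~ y)}) ->
  (forall x y, a <= x <= b -> `|y - y0| < d -> `|fy x y| <= M) ->
  is_derive y0 1 (fun y => integ a b (f^~ y)) (integ a b (fy^~ y0)).
Proof.
move=> d0 df cf fM.
have inI y : y \in `](y0 - d), (y0 + d)[ -> `|y - y0| < d.
  by rewrite in_itv /= ltr_norml; lra.
have mI : measurable (`[a, b] : set R) by [].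
have Iy0 : `](y0 - d), (y0 + d)[%classic y0 by rewrite /= in_itv /=; lra.
have M0 (x : R) : 0 <= Num.max 0 M by rewrite le_max lexx.
have dfE x y : a <= x <= b -> `|y - y0| < d -> partial1of2 (fun y x => f x y) y x = fy x y.
  by move=> xab yd; rewrite partial1of2E /=; have hx := df x y xab yd; exact: derive_val.
have cv : h^-1 *: (integ a b (f^~ (h + y0)) - integ a b (f^~ y0)) @[h --> 0^'] -->
    integ a b (fun x => partial1of2 (fun y x => f x y) y0 x).
  under eq_fun do rewrite !integE; rewrite integE.
  apply: (@cvg_differentiation_under_integral R _ _ lebesgue_measure (fun y x => f x y)
    `[a, b] mI y0 (y0 - d) (y0 + d) Iy0 _ _ (fun=> Num.max 0 M)) => //.
  - by move=> y /inI hy; apply: segment_integrable; exact: cf.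
  - move=> y x /inI hy /=; rewrite in_itv /= => hx.
    by have hd := df x y hx hy; exact: ex_derive.
  - by apply: segment_integrable; exact/cont_within/cont_cst.
  - move=> y x /inI hy /=; rewrite in_itv /= => hx; rewrite dfE //.
    by rewrite le_max fM ?orbT.
have -> : integ a b (fy^~ y0) = integ a b (fun x => partial1of2 (fun y x => f x y) y0 x).
  by apply: eq_integ => x xab; rewrite dfE // subrr normr0.
apply: DeriveDef.
  apply/cvg_ex => /=; exists (integ a b (fun x => partial1of2 (fun y x => f x y) y0 x)).
  by under eq_fun do rewrite scaler1; exact: cv.
rewrite /derive; apply/cvg_lim => //.
by under eq_fun do rewrite scaler1; exact: cv.
Qed.

Lemma integ_slice_continuous (f : R * R -> R) a b : a <= b -> continuous f ->
  continuous (fun y => integ a b (fun x => f (x, y))).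
Proof.
move=> ab cf y0; apply/cvgrPdist_le => eps e0.
have e1 : 0 < eps / (b - a + 1) by rewrite divr_gt0 //; lra.
have [d d0 hd] := @slice_uniform R f a b y0 _ cf e1.
apply/nbhs_ballP; exists d => //= y yd.
have cs z : {within `[a, b], continuous (fun x => f (x, z))}.
  by apply: cont_within; apply: cont_comp2 => //; cont.
rewrite distrC -integB //; apply: le_trans (@norm_integ_le _ _ _ _ (eps / (b - a + 1)) ab _ _) _.
- by move=> x; apply: cvgB; exact: cs.
- by move=> x xab; apply: hd => //; rewrite distrC.
- rewrite mulrAC ler_pdivrMr; last lra.
  by rewrite ler_pM2l //; lra.
Qed.

(** The mean value theorem bounds the difference quotients of [J a] by the values of
    [T a], uniformly in [a], and such bounds pass to the limit. *)
Lemma derive_uniform_limit (J T : R -> R -> R) b m y0 : `|y0| < m ->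
  (forall a y, 0 < a < b -> `|y| < m -> is_derive y 1 (J a) (T a y)) ->
  (forall y eps, `|y| < m -> 0 < eps ->
     exists2 a0, a0 < b & forall a, a0 < a < b -> `|J a y - J b y| <= eps) ->
  (forall eps, 0 < eps ->
     exists2 a0, a0 < b & forall a y, a0 < a < b -> `|y| < m -> `|T a y - T b y| <= eps) ->
  0 < b -> {for y0, continuous (T b)} ->
  is_derive y0 1 (J b) (T b y0).
Proof.
move=> ym dJ cJ cT b0 cTb.
suff key eps : 0 < eps -> \forall y \near y0, `|J b y - J b y0 - T b y0 * (y - y0)| <= eps * `|y - y0|.
  have cv : h^-1 *: (J b (h + y0) - J b y0) @[h --> 0^'] --> T b y0.
    apply/cvgrPdist_le => eps e0.
    have /nbhs_ballP[d /= d0 hd] := key eps e0.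
    apply/nbhs_ballP; exists d => //= h hh h0.
    have hn0 : h != 0 by [].
    have := hd (h + y0); rewrite /ball /= opprD addrCA subrr addr0 normrN addrK => hle.
    have {}hle : `|J b (h + y0) - J b y0 - T b y0 * h| <= eps * `|h|.
      by apply: hle; move: hh; rewrite /ball /= sub0r normrN.
    have -> : T b y0 - h^-1 *: (J b (h + y0) - J b y0) = - (h^-1 * (J b (h + y0) - J b y0 - T b y0 * h)).
      by rewrite /GRing.scale /=; field.
    rewrite normrN normrM normfV mulrC ler_pdivrMr ?normr_gt0 //.
  apply: DeriveDef.
    apply/cvg_ex => /=; exists (T b y0).
    by under eq_fun do rewrite scaler1; exact: cv.
  rewrite /derive; apply/cvg_lim => //.
  by under eq_fun do rewrite scaler1; exact: cv.
move=> e0.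
have e2 : 0 < eps / 3 by lra.
have [a0 a0b ha0] := cT _ e2.
have /cvgrPdist_le/(_ _ e2)/nbhs_ballP[d /= d0 hd] := cTb.
apply/nbhs_ballP; exists (Num.min d (m - `|y0|)); first by rewrite /= lt_min d0 subr_gt0.
move=> y /=; rewrite /ball /= lt_min distrC => /andP[yd ym'].
have [->|ny] := eqVneq y y0; first by rewrite !subrr mulr0 subrr normr0 mulr0.
have yy0 : 0 < `|y - y0| by rewrite normr_gt0 subr_eq0.
have ymm : `|y| < m.
  have := ler_normD y0 (y - y0); rewrite addrC subrK; lra.
have e4 : 0 < eps / 6 * `|y - y0| by apply: mulr_gt0; lra.
have [a1 a1b ha1] := cJ y _ ymm e4.
have [a2 a2b ha2] := cJ y0 _ ym e4.
pose a := (b + Num.max 0 (Num.max a0 (Num.max a1 a2))) / 2.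
have amax : Num.max 0 (Num.max a0 (Num.max a1 a2)) < b by rewrite !gt_max b0 a0b a1b a2b.
have [h0 h1 h2 h3] : [/\ 0 <= Num.max 0 (Num.max a0 (Num.max a1 a2)),
   a0 <= Num.max 0 (Num.max a0 (Num.max a1 a2)), a1 <= Num.max 0 (Num.max a0 (Num.max a1 a2))
   & a2 <= Num.max 0 (Num.max a0 (Num.max a1 a2))] by rewrite !le_max !lexx !orbT.
have [ab0 ab1 ab2 ab3] : [/\ 0 < a < b, a0 < a < b, a1 < a < b & a2 < a < b].
  by rewrite /a; split; lra.
have Jy := ha1 a ab2; have Jy0 := ha2 a ab3.
pose F z := J a z - T b y0 * z.
have inm z : (y0 < z < y) || (y < z < y0) -> `|z| < m.
  by move: ym ymm; rewrite !ltr_norml => ? ? /orP[]; lra.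
have dF z : `|z| < m -> is_derive z 1 F (T a z - T b y0).
  move=> zm; have := dJ a z ab0 zm => dJz; by rewrite /F; derive_with.
have bound z : (y0 < z < y) || (y < z < y0) -> `|T a z - T b y0| <= eps / 3 + eps / 3.
  move=> hz; have zm := inm z hz.
  have t1 := ha0 a z ab1 zm.
  have t2 : `|T b y0 - T b z| <= eps / 3.
    by apply: hd; rewrite /ball /=; move: yd; rewrite !ltr_norml; case/orP: hz; lra.
  move: t1 t2; rewrite !ler_norml; lra.
have cF z : `|z| < m -> {for z, continuous F} by move=> /dF; exact: der_cont.
have FB : `|F y - F y0| <= (eps / 3 + eps / 3) * `|y - y0|.
  have [lt|lt|eyy] := ltgtP y0 y; last by rewrite eyy eqxx in ny.
  - have [||z zi ->] := @MVT _ F (fun z => T a z - T b y0) y0 y lt.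
    + by move=> z; rewrite in_itv /= => hz; apply/dF/inm; rewrite hz.
    + apply: continuous_in_subspaceT => z /set_mem /=; rewrite in_itv /= => hz; apply: cF.
      by move: ym ymm; rewrite !ltr_norml; lra.
    rewrite normrM ler_wpM2r //; apply: bound; rewrite in_itv /= in zi; by rewrite zi.
  - have [||z zi e] := @MVT _ F (fun z => T a z - T b y0) y y0 lt.
    + by move=> z; rewrite in_itv /= => hz; apply/dF/inm; rewrite hz orbT.
    + apply: continuous_in_subspaceT => z /set_mem /=; rewrite in_itv /= => hz; apply: cF.
      by move: ym ymm; rewrite !ltr_norml; lra.
    rewrite distrC e normrM (distrC y0) ler_wpM2r //; apply: bound.
    by rewrite in_itv /= in zi; rewrite zi orbT.
have -> : J b y - J b y0 - T b y0 * (y - y0)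
  = (F y - F y0) + ((J b y - J a y) + (J a y0 - J b y0)) by rewrite /F; ring.
apply: le_trans (ler_normD _ _) _.
apply: le_trans (lerD FB (ler_normD _ _)) _.
by move: Jy Jy0; rewrite distrC; lra.
Qed.

End ParametricIntegrals.

(** * One-dimensional Robin modes and Riccati bounds *)

Section OneDimensional.
Variable R : realType.
Variables (b h : R).
Hypothesis b_half_pi : b = pi / 2.
Implicit Types (f F w u : R -> R) (x p q k c lam : R).

Fact half_side_gt0 : 0 < b. Proof. by rewrite b_half_pi pihalf_gt0. Qed.

Record mode k (u u1 : R -> R) : Prop := Mode {
  mode_der : forall x, is_derive x 1 u (u1 x);
  mode_der1 : forall x, is_derive x 1 u1 (- (k ^+ 2) * u x);
  mode_right : u1 b = - h * u b;
  mode_left : u1 (- b) = h * u (- b) }.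

Lemma mode_cont k u u1 : mode k u u1 -> continuous u.
Proof. by move=> [d _ _ _] x; exact: der_cont (d x). Qed.

Lemma mode_cont1 k u u1 : mode k u u1 -> continuous u1.
Proof. by move=> [_ d _ _] x; exact: der_cont (d x). Qed.

Lemma cos_mode k : k * sin (k * b) = h * cos (k * b) ->
  mode k (fun x => cos (k * x)) (fun x => - k * sin (k * x)).
Proof.
move=> e; split => [x|x||].
- by derive_with; ring.
- by derive_with; rewrite mulNr; ring.
- by rewrite mulNr e mulNr.
- by rewrite !mulrN sinN cosN mulrNN e.
Qed.

Lemma sin_mode k : k * cos (k * b) = - h * sin (k * b) ->
  mode k (fun x => sin (k * x)) (fun x => k * cos (k * x)).
Proof.
move=> e; split => [x|x||].
- by derive_with; ring.
- by derive_with; ring.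
- exact: e.
- by rewrite !mulrN sinN cosN e; ring.
Qed.

(** The ends are excluded from the differentiability requirement because slices of an
    eigenfunction are only differentiable inside. *)
Definition C1_inside f (f1 : R -> R) : Prop := [/\ continuous f, continuous f1
  & forall x, - b < x < b -> is_derive x 1 f (f1 x)].

Lemma mode_C1 k u u1 : mode k u u1 -> C1_inside u u1.
Proof. by move=> m; split; [exact: mode_cont m|exact: mode_cont1 m|move=> x _; exact: mode_der m x]. Qed.

Definition robin_form lam f (f1 : R -> R) : R :=
  integ (- b) b (fun x => f1 x ^+ 2 - lam * f x ^+ 2) + h * (f b ^+ 2 + f (- b) ^+ 2).

(** Integration by parts; the boundary terms are those of the Robin condition. *)
Lemma integ_mode_parts k u u1 f (f1 : R -> R) : mode k u u1 -> C1_inside f f1 ->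
  integ (- b) b (fun x => f1 x * u1 x) =
  k ^+ 2 * integ (- b) b (fun x => f x * u x) - h * (f b * u b + f (- b) * u (- b)).
Proof.
move=> m [cf cf1 df]; have b0 := half_side_gt0.
have cu := mode_cont m; have cu1 := mode_cont1 m.
have := @integ_ftc R (- b) b (fun x => f1 x * u1 x + - (k ^+ 2) * (f x * u x)) (fun x => f x * u1 x).
have bb : - b < b by lra.
move=> /(_ bb) H.
have {}H : integ (- b) b (fun x => f1 x * u1 x + - (k ^+ 2) * (f x * u x)) = f b * u1 b - f (- b) * u1 (- b).
  apply: H; try by (apply: cont_within; cont).
  move=> x hx; have d1 := df x hx; have d2 := mode_der1 m x.
  by derive_with; ring.
move: H; rewrite integD; [|by apply: cont_within; cont..].
rewrite integZ; last by apply: cont_within; cont.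
by rewrite (mode_right m) (mode_left m); lra.
Qed.

(** In the quadratic form, a mode is orthogonal to everything that is
    [L2]-orthogonal to it, and modes below [lam] only decrease the form. *)
Lemma robin_form_add_mode lam k u u1 f f1 c : mode k u u1 -> C1_inside f f1 ->
  integ (- b) b (fun x => f x * u x) = 0 -> k ^+ 2 <= lam ->
  robin_form lam (fun x => f x + c * u x) (fun x => f1 x + c * u1 x) <= robin_form lam f f1.
Proof.
move=> m [cf cf1 df] orth klam.
have e1 := integ_mode_parts m (And3 cf cf1 df).
have e2 := integ_mode_parts m (mode_C1 m).
have cu := mode_cont m; have cu1 := mode_cont1 m.
have N0 : 0 <= integ (- b) b (fun x => u x * u x) by apply: integ_ge0 => x _; rewrite -expr2 sqr_ge0.
have -> : robin_form lam (fun x => f x + c * u x) (fun x => f1 x + c * u1 x) =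
   robin_form lam f f1 + c ^+ 2 * ((k ^+ 2 - lam) * integ (- b) b (fun x => u x * u x)).
  rewrite /robin_form.
  have -> : integ (- b) b (fun x => (f1 x + c * u1 x) ^+ 2 - lam * (f x + c * u x) ^+ 2) =
    integ (- b) b (fun x => f1 x ^+ 2 - lam * f x ^+ 2) +
    (2 * c * integ (- b) b (fun x => f1 x * u1 x) - 2 * c * lam * integ (- b) b (fun x => f x * u x) +
     (c ^+ 2 * integ (- b) b (fun x => u1 x * u1 x) - c ^+ 2 * lam * integ (- b) b (fun x => u x * u x))).
    rewrite -!integZ; try by (apply: cont_within; cont).
    rewrite -!integB; try by (apply: cont_within; cont).
    rewrite -!integD; try by (apply: cont_within; cont).
    by apply: eq_integ => x _; ring.
  by rewrite e1 e2 orth; ring.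
rewrite gerDl; apply: mulr_ge0_le0; first exact: sqr_ge0.
by rewrite mulr_le0_ge0 // subr_le0.
Qed.

Lemma modes_orthogonal k k' u u1 v v1 : mode k u u1 -> mode k' v v1 -> k ^+ 2 != k' ^+ 2 ->
  integ (- b) b (fun x => u x * v x) = 0.
Proof.
move=> mu mv kk.
have e1 := integ_mode_parts mv (mode_C1 mu).
have e2 := integ_mode_parts mu (mode_C1 mv).
have E (f g : R -> R) : integ (- b) b (fun x => f x * g x) = integ (- b) b (fun x => g x * f x).
  by apply: eq_integ => x _; rewrite mulrC.
rewrite E e2 E in e1.
have : (k ^+ 2 - k' ^+ 2) * integ (- b) b (fun x => u x * v x) = 0.
  by rewrite [v b * _]mulrC [v (- b) * _]mulrC in e1; rewrite mulrBl; lra.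
by move/eqP; rewrite mulf_eq0 subr_eq0 (negbTE kk) /= => /eqP.
Qed.

(** The square [(F1 - F * w)^2] integrates to a lower bound whenever [w] solves
    the Riccati equation [w' = - K - w^2]. *)
Lemma riccati_lower_bound (K : R) p q F (F1 : R -> R) w : p < q -> continuous F -> continuous F1 ->
  (forall x, p < x < q -> is_derive x 1 F (F1 x)) ->
  {within `[p, q], continuous w} ->
  (forall x, p < x < q -> is_derive x 1 w (- K - w x ^+ 2)) ->
  F q ^+ 2 * w q - F p ^+ 2 * w p <= integ p q (fun x => F1 x ^+ 2 - K * F x ^+ 2).
Proof.
move=> pq cF cF1 dF cw dw.
have cF2 : {within `[p, q], continuous F} by exact: cont_within.
have cF3 : {within `[p, q], continuous F1} by exact: cont_within.
pose D x := 2 * F x * F1 x * w x + F x ^+ 2 * (- K - w x ^+ 2).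
have cD : {within `[p, q], continuous D}.
  have C0 (z : R) : {within `[p, q], continuous (fun=> z)} by exact/cont_within/cont_cst.
  move=> x; rewrite /D; apply: cvgD.
    by apply: cvgM; [apply: cvgM; [apply: cvgM; [exact: C0|exact: cF2]|exact: cF3]|exact: cw].
  apply: cvgM; first by rewrite expr2; apply: cvgM; exact: cF2.
  apply: cvgB; first exact: C0.
  by rewrite expr2; apply: cvgM; exact: cw.
have <- : integ p q D = F q ^+ 2 * w q - F p ^+ 2 * w p.
  apply: (@integ_ftc _ p q D (fun x => F x ^+ 2 * w x)) => //.
    move=> x; apply: cvgM; last exact: cw.
    by rewrite expr2; apply: cvgM; exact: cF2.
  move=> x hx; have d1 := dF x hx; have d2 := dw x hx.
  by derive_with; rewrite /D; ring.
apply: le_integ => //; first by apply: cont_within; cont.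
move=> x _; rewrite /D.
have : 0 <= (F1 x - F x * w x) ^+ 2 by exact: sqr_ge0.
lra.
Qed.

(** This is [w' = - (7 / 2) ^ 2 - w ^ 2], and it stays finite on [p, p + pi / 4] because
    the angle runs there from [margin] to [pi - margin]. *)
Definition riccati p x : R := 7 / 2 * (cos (7 / 2 * (x - p) + margin R) / sin (7 / 2 * (x - p) + margin R)).

Lemma riccati_piece p F (F1 : R -> R) : continuous F -> continuous F1 ->
  (forall x, p < x < p + pi / 4 -> is_derive x 1 F (F1 x)) ->
  - (7 / 2 * (cos (margin R) / sin (margin R))) * (F (p + pi / 4) ^+ 2 + F p ^+ 2)
   <= integ p (p + pi / 4) (fun x => F1 x ^+ 2 - 49 / 4 * F x ^+ 2).
Proof.
move=> cF cF1 dF; have p0 := pi_gt0 R.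
have sgt x : p <= x <= p + pi / 4 -> 0 < sin (7 / 2 * (x - p) + margin R).
  by move=> hx; apply: sin_gt0_pi; rewrite /margin; lra.
have dw x : p <= x <= p + pi / 4 -> is_derive x 1 (riccati p) (- (49 / 4) - riccati p x ^+ 2).
  move=> hx; have s0 := sgt x hx; have sn0 : sin (7 / 2 * (x - p) + margin R) != 0 by rewrite gt_eqF.
  pose t y : R := 7 / 2 * (y - p) + margin R.
  have dt : is_derive x 1 t (7 / 2) by rewrite /t; derive_with; ring.
  have ds : is_derive x 1 (fun y => sin (t y)) (7 / 2 * cos (t x)) by derive_with; ring.
  have dc : is_derive x 1 (fun y => cos (t y)) (- (7 / 2) * sin (t x)) by derive_with; ring.
  have dv := @is_deriveV R (fun y => sin (t y)) x _ 1 sn0 ds.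
  have -> : riccati p = (fun y => 7 / 2 * (cos (t y) * (sin (t y))^-1)) by [].
  have dv' : is_derive x 1 (fun y => (sin (t y))^-1) (- (sin (t x)) ^- 2 *: (7 / 2 * cos (t x))) by exact: dv.
  derive_with; rewrite /GRing.scale /=.
  move: sn0; rewrite -/(t x); move: (sin (t x)) (cos (t x)) => S C S0.
  by field.
have := @riccati_lower_bound (49 / 4) p (p + pi / 4) F F1 (riccati p) _ cF cF1 dF _ _.
move=> H; apply: le_trans (H _ _ _); first last.
- by move=> x hx; apply: dw; lra.
- apply: continuous_in_subspaceT => x /set_mem /=; rewrite in_itv /= => /dw; exact: der_cont.
- lra.
have -> : riccati p p = 7 / 2 * (cos (margin R) / sin (margin R)).
  by rewrite /riccati subrr mulr0 add0r.
have -> : riccati p (p + pi / 4) = - (7 / 2 * (cos (margin R) / sin (margin R))).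
  rewrite /riccati; have -> : 7 / 2 * (p + pi / 4 - p) + margin R = pi - margin R by rewrite /margin; lra.
  by rewrite cosB sinB cospi sinpi !mul0r addr0 sub0r !mulN1r opprK mulNr mulrN.
by move: (7 / 2 * _) => z; lra.
Qed.

End OneDimensional.

(** * Positivity of the Robin form above the third mode *)

Section Frequencies.
Variable R : realType.
Variables (h : R) (s : nat -> R).
Hypothesis h_large : h_threshold R < h.
Hypothesis s_angle : forall j, (j <= 2)%N -> robin_angle j h (s j).
Let b : R := pi / 2.

Definition freq j : R := j.+1%:R - s j / (pi / 2).

Fact h_gt0 : 0 < h. Proof. exact: lt_trans (h_threshold_gt0 R) h_large. Qed.

Fact angle_bounds j : (j <= 2)%N -> 0 < s j < margin R.
Proof.
move=> j2; have a := s_angle j2; rewrite (robin_angle_lt_margin j2 h_large a) andbT.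
by case: a => /andP[].
Qed.

Lemma freq_bounds j : (j <= 2)%N -> j.+1%:R - 1 / 8 < freq j < j.+1%:R.
Proof.
move=> /angle_bounds; rewrite /freq /margin; have p0 := pi_gt0 R.
set u := s j / (pi / 2) => /andP[s0 s1].
have u0 : 0 < u by rewrite divr_gt0 //; lra.
have u1 : u < 1 / 8 by rewrite ltr_pdivrMr; lra.
by move: u0 u1; clear; move=> u0 u1; apply/andP; split; lra.
Qed.

Fact freq_side j : freq j * b = j.+1%:R * (pi / 2) - s j.
Proof.
rewrite /freq mulrBl divfK // gt_eqF //; have := pi_gt0 R; lra.
Qed.

Lemma freq_eq j : (j <= 2)%N -> freq j * cos (s j) = h * sin (s j).
Proof. by move=> /s_angle[]. Qed.

Lemma mode0 : mode b h (freq 0) (fun x => cos (freq 0 * x)) (fun x => - freq 0 * sin (freq 0 * x)).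
Proof.
apply: cos_mode; rewrite freq_side mul1r sinB cosB sin_pihalf cos_pihalf.
by have := @freq_eq 0 isT; lra.
Qed.

Lemma mode1 : mode b h (freq 1) (fun x => sin (freq 1 * x)) (fun x => freq 1 * cos (freq 1 * x)).
Proof.
apply: sin_mode; rewrite freq_side.
have -> : 2%:R * (pi / 2) - s 1%N = pi - s 1%N :> R by lra.
by rewrite sinB cosB sinpi cospi; have := @freq_eq 1 isT; lra.
Qed.

Lemma mode2 : mode b h (freq 2) (fun x => cos (freq 2 * x)) (fun x => - freq 2 * sin (freq 2 * x)).
Proof.
apply: cos_mode; rewrite freq_side.
have -> : 3%:R * (pi / 2) - s 2%N = pi / 2 - s 2%N + pi :> R by lra.
by rewrite sinDpi cosDpi sinB cosB sin_pihalf cos_pihalf; have := @freq_eq 2 isT; lra.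
Qed.

Definition lam02 : R := freq 0 ^+ 2 + freq 2 ^+ 2.

Lemma lam02_bounds : 9 < lam02 < 10.
Proof.
have := @freq_bounds 0 isT; have := @freq_bounds 2 isT; rewrite /lam02.
move: (freq 0) (freq 2) => x y; nra.
Qed.

(** For a function vanishing at the three nodes [0], [pi/4], [-pi/4], the form
    splits into four intervals of length [pi/4], on each of which a Riccati
    solution exists for every spectral parameter up to [49/4]. *)
Lemma robin_form_nodes lam (F F1 : R -> R) : lam <= 49 / 4 -> C1_inside b F F1 ->
  F 0 = 0 -> F (pi / 4) = 0 -> F (- (pi / 4)) = 0 -> 0 <= robin_form b h lam F F1.
Proof.
move=> laml [cF cF1 dF] F0 Fp Fm; have p0 := pi_gt0 R.
have sm := sin_margin_gt0 R; have cm := cos_margin_gt0 R.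
pose ct := 7 / 2 * (cos (margin R) / sin (margin R)).
have hct : ct <= h.
  have := lt_h_thresholdP h_large; rewrite /ct mulrA => H.
  rewrite ler_pdivrMr //; lra.
pose I p := integ p (p + pi / 4) (fun x => F1 x ^+ 2 - 49 / 4 * F x ^+ 2).
have piece p : - b <= p -> p + pi / 4 <= b -> - ct * (F (p + pi / 4) ^+ 2 + F p ^+ 2) <= I p.
  move=> p1 p2; apply: (@riccati_piece R p F F1 cF cF1) => x hx; apply: dF.
  by move: p1 p2; rewrite /b; lra.
have cI u v : {within `[u, v], continuous (fun x => F1 x ^+ 2 - 49 / 4 * F x ^+ 2)}.
  by apply: cont_within; cont.
have eb1 : - b + pi / 4 = - (pi / 4) by rewrite /b; lra.
have eb2 : pi / 4 + pi / 4 = b by rewrite /b; lra.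
have split4 : integ (- b) b (fun x => F1 x ^+ 2 - 49 / 4 * F x ^+ 2)
    = I (- b) + (I (- (pi / 4)) + (I 0 + I (pi / 4))).
  rewrite /I addNr add0r.
  rewrite (@integ_split R (- b) (- (pi / 4)) b) //; [|rewrite /b; lra..].
  rewrite (@integ_split R (- (pi / 4)) 0 b) //; [|rewrite /b; lra..].
  rewrite (@integ_split R 0 (pi / 4) b) //; [|rewrite /b; lra..].
  by rewrite eb1 eb2.
have i1 := piece (- b); have i2 := piece (- (pi / 4)); have i3 := piece 0; have i4 := piece (pi / 4).
rewrite eb1 Fm expr0n /= add0r in i1.
rewrite addNr F0 Fm expr0n /= addr0 mulr0 in i2.
rewrite add0r F0 Fp expr0n /= addr0 mulr0 in i3.
rewrite eb2 Fp expr0n /= addr0 in i4.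
have {}i1 : - ct * F (- b) ^+ 2 <= I (- b) by apply: i1; rewrite /b; lra.
have {}i2 : 0 <= I (- (pi / 4)) by apply: i2; rewrite /b; lra.
have {}i3 : 0 <= I 0 by apply: i3; rewrite /b; lra.
have {}i4 : - ct * F b ^+ 2 <= I (pi / 4) by apply: i4; rewrite /b; lra.
have mono : integ (- b) b (fun x => F1 x ^+ 2 - 49 / 4 * F x ^+ 2)
    <= integ (- b) b (fun x => F1 x ^+ 2 - lam * F x ^+ 2).
  apply: le_integ; try by (apply: cont_within; cont).
  by move=> x _; rewrite lerD2l lerN2 ler_wpM2r // sqr_ge0.
rewrite /robin_form.
have q1 : ct * F b ^+ 2 <= h * F b ^+ 2 by rewrite ler_wpM2r // sqr_ge0.
have q2 : ct * F (- b) ^+ 2 <= h * F (- b) ^+ 2 by rewrite ler_wpM2r // sqr_ge0.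
move: mono; rewrite split4.
move: i1 i2 i3 i4 q1 q2; move: (I _) (I _) (I _) (I _) => I1 I2 I3 I4.
move: (integ _ _ _) (F b ^+ 2) (F (- b) ^+ 2) => J X Y.
lra.
Qed.

Fact cos_nodes_neq : cos (freq 0 * (pi / 4)) != cos (freq 2 * (pi / 4)).
Proof.
have p0 := pi_gt0 R; have := @freq_bounds 0 isT; have := @freq_bounds 2 isT.
move: (freq 0) (freq 2) => x y hx hy.
have x1 : 0 < x * (pi / 4) by apply: mulr_gt0; lra.
have y1 : y * (pi / 4) <= 3 * (pi / 4) by rewrite ler_pM2r; lra.
have xy : x * (pi / 4) < y * (pi / 4) by rewrite ltr_pM2r; lra.
by rewrite gt_eqF // ltr_cos ?in_itv //=; lra.
Qed.

Fact sin_node_gt0 : 0 < sin (freq 1 * (pi / 4)).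
Proof.
have p0 := pi_gt0 R; have := @freq_bounds 1 isT.
move: (freq 1) => x hx.
have x1 : 0 < x * (pi / 4) by apply: mulr_gt0; lra.
have y1 : x * (pi / 4) <= 2 * (pi / 4) by rewrite ler_pM2r; lra.
by apply: sin_gt0_pi; lra.
Qed.

(** Courant's argument: adding to [f] the combination of the three modes that
    makes it vanish at the nodes can only decrease the form. *)
Lemma robin_form_ge0 (f f1 : R -> R) : C1_inside b f f1 ->
  integ (- b) b (fun x => f x * cos (freq 0 * x)) = 0 ->
  integ (- b) b (fun x => f x * sin (freq 1 * x)) = 0 ->
  integ (- b) b (fun x => f x * cos (freq 2 * x)) = 0 ->
  0 <= robin_form b h lam02 f f1.
Proof.
move=> C1f o0 o1 o2.
have hb : b = pi / 2 by [].
have lb := lam02_bounds.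
have b0 := @freq_bounds 0 isT; have b1 := @freq_bounds 1 isT; have b2 := @freq_bounds 2 isT.
have C1D k u u1 (g g1 : R -> R) c : mode b h k u u1 -> C1_inside b g g1 ->
    C1_inside b (fun x => g x + c * u x) (fun x => g1 x + c * u1 x).
  move=> m [cg cg1 dg]; have cu := mode_cont m; have cu1 := mode_cont1 m.
  split; [by cont|by cont|move=> x hx].
  by have d1 := dg x hx; have d2 := mode_der m x; derive_with; ring.
pose C0 := cos (freq 0 * (pi / 4)); pose C2 := cos (freq 2 * (pi / 4)); pose S1 := sin (freq 1 * (pi / 4)).
have CC : C2 - C0 != 0 by rewrite subr_eq0 eq_sym cos_nodes_neq.
have SS : S1 != 0 by rewrite gt_eqF // sin_node_gt0.
pose e := (f (pi / 4) + f (- (pi / 4))) / 2.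
pose c2 := (f 0 * C0 - e) / (C2 - C0); pose c0 := - f 0 - c2.
pose c1 := - ((f (pi / 4) - f (- (pi / 4))) / 2) / S1.
have m0 := mode0; have m1 := mode1; have m2 := mode2.
have D1 := C1D _ _ _ _ _ c0 m0 C1f.
have D2 := C1D _ _ _ _ _ c2 m2 D1.
have D3 := C1D _ _ _ _ _ c1 m1 D2.
have cc0 := mode_cont m0; have cc1 := mode_cont m1; have cc2 := mode_cont m2.
have [cf _ _] := C1f.
have n02 : freq 0 ^+ 2 != freq 2 ^+ 2.
  by rewrite lt_eqF //; move: b0 b2; move: (freq 0) (freq 2) => x y; nra.
have n01 : freq 0 ^+ 2 != freq 1 ^+ 2.
  by rewrite lt_eqF //; move: b0 b1; move: (freq 0) (freq 1) => x y; nra.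
have n21 : freq 2 ^+ 2 != freq 1 ^+ 2.
  by rewrite gt_eqF //; move: b2 b1; move: (freq 2) (freq 1) => x y; nra.
have t02 := modes_orthogonal hb m0 m2 n02.
have t01 := modes_orthogonal hb m0 m1 n01.
have t21 := modes_orthogonal hb m2 m1 n21.
have k0l : freq 0 ^+ 2 <= lam02 by rewrite /lam02 lerDl sqr_ge0.
have k2l : freq 2 ^+ 2 <= lam02 by rewrite /lam02 lerDr sqr_ge0.
have k1l : freq 1 ^+ 2 <= lam02 by move: lb b1; move: (freq 1) lam02 => x y; nra.
have orthD (g u v : R -> R) c : continuous g -> continuous u -> continuous v ->
    integ (- b) b (fun x => g x * v x) = 0 -> integ (- b) b (fun x => u x * v x) = 0 ->
    integ (- b) b (fun x => (g x + c * u x) * v x) = 0.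
  move=> cg cu cv g0 u0.
  have -> : integ (- b) b (fun x => (g x + c * u x) * v x) =
     integ (- b) b (fun x => g x * v x) + c * integ (- b) b (fun x => u x * v x).
    rewrite -integZ; last by apply: cont_within; cont.
    rewrite -integD; try by (apply: cont_within; cont).
    by apply: eq_integ => x _; ring.
  by rewrite g0 u0 mulr0 addr0.
have o2' := orthD _ _ _ c0 cf cc0 cc2 o2 t02.
have o1' := orthD _ _ _ c0 cf cc0 cc1 o1 t01.
have cf' : continuous (fun x => f x + c0 * cos (freq 0 * x)) by cont.
have o1'' := orthD _ _ _ c2 cf' cc2 cc1 o1' t21.
apply: le_trans (robin_form_add_mode hb c0 m0 C1f o0 k0l).
apply: le_trans (robin_form_add_mode hb c2 m2 D1 o2' k2l).
apply: le_trans (robin_form_add_mode hb c1 m1 D2 o1'' k1l).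
have eC2 : c2 * (C2 - C0) = f 0 * C0 - e by rewrite /c2 divfK.
have eS1 : c1 * S1 = - ((f (pi / 4) - f (- (pi / 4))) / 2) by rewrite /c1 divfK.
apply: robin_form_nodes => //.
- by move: lb; lra.
- by rewrite !mulr0 cos0 sin0 /c0; lra.
- rewrite -/C0 -/C2 -/S1 /c0; move: eC2 eS1; rewrite /e; lra.
- rewrite !mulrN !cosN sinN -/C0 -/C2 -/S1 /c0; move: eC2 eS1; rewrite /e; lra.
Qed.

End Frequencies.

(** * Integrals over slices and the Robin ordinary differential equation *)

Section SliceIntegrals.
Variable R : realType.
Variable b : R.
Hypothesis b_gt0 : 0 < b.
Implicit Types (V W P Q : R * R -> R) (a x y eps : R).

Fact sideN_le : - b <= b. Proof. by have bg := b_gt0; lra. Qed.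

Definition open_box x y : Prop := `|x| < b /\ `|y| < b.

Lemma slice_cont1 V y : continuous V -> continuous (fun x => V (x, y)).
Proof. by move=> cV; apply: cont_comp2 => //; cont. Qed.

Lemma slice_cont2 V x : continuous V -> continuous (fun y => V (x, y)).
Proof. by move=> cV; apply: cont_comp2 => //; cont. Qed.

Lemma integ_trunc V eps : continuous V -> 0 < eps ->
  exists2 a0, a0 < b & forall a y, a0 < a < b -> `|y| < b ->
    `|integ (- a) a (fun x => V (x, y)) - integ (- b) b (fun x => V (x, y))| <= eps.
Proof.
have bg := b_gt0.
move=> cV e0.
have [M M0 hM] := @bounded_on_box R V (- b) b (- b) b (fun x y _ _ => cV (x, y)).
pose d := eps / (2 * (M + 1)).
have d0 : 0 < d by rewrite divr_gt0 //; lra.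
exists (Num.max 0 (b - d)); first by rewrite gt_max b_gt0 /=; lra.
move=> a y; rewrite gt_max => /andP[/andP[a0 ad] ab] yb.
have cs : continuous (fun x => V (x, y)) by exact: slice_cont1.
have cw u v : {within `[u, v], continuous (fun x => V (x, y))} by exact: cont_within.
rewrite (@integ_split R (- b) (- a) b) //; [|lra..].
rewrite (@integ_split R (- a) a b) //; [|lra..].
have yb' : - b <= y <= b by move: yb; rewrite ltr_norml; lra.
have n1 : `|integ (- b) (- a) (fun x => V (x, y))| <= M * (- a - - b).
  by apply: norm_integ_le => //; [lra|move=> x hx; apply: hM => //; lra].
have n2 : `|integ a b (fun x => V (x, y))| <= M * (b - a).
  by apply: norm_integ_le => //; [lra|move=> x hx; apply: hM => //; lra].
have e1 : (M + 1) * (2 * d) = eps by rewrite /d; field; rewrite gt_eqF //; lra.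
have e2 : M * (b - a) <= (M + 1) * d by apply: ler_pM; lra.
have e3 : M * (- a - - b) = M * (b - a) by ring.
rewrite e3 in n1.
move: n1 n2 e1 e2; move: (integ _ _ _) (integ _ _ _) (integ _ _ _) (M * _) => I1 I2 I3 z.
rewrite !ler_norml; move: ((M + 1) * d) (mulrCA (M + 1) 2 d) => t -> ; lra.
Qed.

(** The ends of the slice, where the integrand need not be differentiable, are reached
    by letting shorter slices grow. *)
Lemma slice_integ_derive V Vy y0 : continuous V -> continuous Vy ->
  (forall x y, open_box x y -> is_derive y 1 (fun y => V (x, y)) (Vy (x, y))) ->
  `|y0| < b ->
  is_derive y0 1 (fun y => integ (- b) b (fun x => V (x, y)))
                 (integ (- b) b (fun x => Vy (x, y0))).
Proof.
have bg := b_gt0.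
move=> cV cVy dV yb.
pose J a y := integ (- a) a (fun x => V (x, y)).
pose T a y := integ (- a) a (fun x => Vy (x, y)).
apply: (@derive_uniform_limit R J T b b y0) => //.
- move=> a y /andP[a0 ab] yb'.
  have [M M0 hM] := @bounded_on_box R Vy (- b) b (- b) b (fun x y _ _ => cVy (x, y)).
  have d0 : 0 < b - `|y| by rewrite subr_gt0.
  have inb z : `|z - y| < b - `|y| -> `|z| < b.
    by have := ler_normD y (z - y); rewrite addrC subrK; lra.
  apply: (@integ_derive_param R (fun x y => V (x, y)) (fun x y => Vy (x, y)) (- a) a y _ M d0).
  + move=> x z hx /inb hz; apply: dV; split => //; rewrite ltr_norml; lra.
  + by move=> z _; apply: cont_within; exact: slice_cont1.
  + move=> x z hx /inb; rewrite ltr_norml => hz; apply: hM; lra.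
- move=> y eps yb' e0; have [a0 a0b h] := integ_trunc cV e0.
  by exists a0 => // a ha; exact: h.
- by move=> eps e0; exact: integ_trunc.
- by apply: integ_slice_continuous => //; exact: sideN_le.
Qed.

Lemma slice_uniform1 P x0 eps : continuous P -> 0 < eps ->
  exists2 d, 0 < d & forall x, `|x - x0| < d -> forall y, `|y| < b ->
    `|P (x, y) - P (x0, y)| <= eps.
Proof.
have bg := b_gt0.
move=> cP e0.
have cS : continuous (fun p : R * R => P (p.2, p.1)) by apply: cont_comp2 => //; cont.
have [d d0 hd] := @slice_uniform R _ (- b) b x0 eps cS e0.
exists d => // x xd y yb; apply: (hd x xd y); move: yb; rewrite ltr_norml; lra.
Qed.

(** The second derivative exists only inside the box and may be unbounded near
    its sides; it suffices that its truncated integrals be given by expressions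
    that are continuous up to the sides. *)
Lemma slice_integ_derive2 Vy Vyy W P Q y0 : continuous Vy ->
  (forall x y, open_box x y -> {for (x, y), continuous Vyy}) ->
  (forall x y, open_box x y -> is_derive y 1 (fun y => Vy (x, y)) (Vyy (x, y))) ->
  continuous W -> continuous P -> continuous Q ->
  (forall a y, 0 < a < b -> `|y| < b -> integ (- a) a (fun x => Vyy (x, y)) =
     integ (- a) a (fun x => W (x, y)) + (P (a, y) + Q (- a, y))) ->
  `|y0| < b ->
  is_derive y0 1 (fun y => integ (- b) b (fun x => Vy (x, y)))
     (integ (- b) b (fun x => W (x, y0)) + (P (b, y0) + Q (- b, y0))).
Proof.
have bg := b_gt0.
move=> cVy cVyy dVy cW cP cQ HT yb.
pose J a y := integ (- a) a (fun x => Vy (x, y)).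
pose T a y := integ (- a) a (fun x => W (x, y)) + (P (a, y) + Q (- a, y)).
apply: (@derive_uniform_limit R J T b b y0) => //.
- move=> a y /andP[a0 ab] yb'.
  have d0 : 0 < (b - `|y|) / 2 by rewrite divr_gt0 // subr_gt0.
  pose d := (b - `|y|) / 2.
  have inb z : `|z - y| < d -> `|z| < b.
    by have := ler_normD y (z - y); rewrite addrC subrK /d; lra.
  have inb' z : y - d <= z <= y + d -> `|z| < b.
    have [y1 y2] : - `|y| <= y /\ y <= `|y| by split; [rewrite lerNl -normrN ler_norm|exact: ler_norm].
    by rewrite /d ltr_norml; lra.
  have ina x : - a <= x <= a -> `|x| < b by rewrite ltr_norml; lra.
  have [M M0 hM] := @bounded_on_box R Vyy (- a) a (y - d) (y + d)
     (fun x z hx hz => cVyy x z (conj (ina x hx) (inb' z hz))).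
  rewrite /T -HT ?a0 ?ab //.
  apply: (@integ_derive_param R (fun x y => Vy (x, y)) (fun x y => Vyy (x, y)) (- a) a y _ M d0).
  + by move=> x z /ina hx /inb hz; apply: dVy.
  + by move=> z _; apply: cont_within; exact: slice_cont1.
  + by move=> x z hx; rewrite -/d ltr_norml => hz; apply: hM => //; lra.
- move=> y eps yb' e0; have [a0 a0b h] := integ_trunc cVy e0.
  by exists a0 => // a ha; exact: h.
- move=> eps e0; have e3 : 0 < eps / 3 by lra.
  have [a0 a0b h0] := integ_trunc cW e3.
  have [d1 d10 h1] := @slice_uniform1 P b _ cP e3.
  have [d2 d20 h2] := @slice_uniform1 Q (- b) _ cQ e3.
  exists (Num.max a0 (Num.max (b - d1) (b - d2))).
    by rewrite !gt_max a0b /=; lra.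
  move=> a y; rewrite !gt_max => /andP[/andP[aa0 /andP[ad1 ad2]] ab] yb'.
  have t0 := h0 a y; rewrite aa0 ab in t0; have {}t0 := t0 isT yb'.
  have t1 : `|P (a, y) - P (b, y)| <= eps / 3 by apply: h1 => //; rewrite ltr_norml; lra.
  have t2 : `|Q (- a, y) - Q (- b, y)| <= eps / 3 by apply: h2 => //; rewrite ltr_norml; lra.
  move: t0 t1 t2; rewrite /T; move: (integ _ _ _) (integ _ _ _) => I1 I2.
  move: (P _) (P _) (Q _) (Q _) => p1 p2 q1 q2.
  rewrite !ler_norml; lra.
- have cT : continuous (T b).
    rewrite /T; apply: contD; first by apply: integ_slice_continuous => //; exact: sideN_le.
    by apply: contD; exact: slice_cont2.
  exact: cT.
Qed.

End SliceIntegrals.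

Arguments slice_cont1 {R V} y.
Arguments slice_cont2 {R V} x.

Section RobinODE.
Variable R : realType.
Variables (b h : R).
Hypothesis b_gt0 : 0 < b.
Implicit Types (k x y z : R).

Lemma ge0_derive_le (f f1 : R -> R) x y : continuous f ->
  (forall z, `|z| < b -> is_derive z 1 f (f1 z)) -> (forall z, `|z| < b -> 0 <= f1 z) ->
  - b <= x -> x <= y -> y <= b -> f x <= f y.
Proof.
have bg := b_gt0.
move=> cf df f0 bx xy yb; have [->//|nxy] := eqVneq x y.
have lt : x < y by rewrite lt_neqAle nxy.
have [|z] := @MVT _ f f1 x y lt _ (cont_within cf).
  by move=> z; rewrite in_itv /= => hz; apply: df; rewrite ltr_norml; lra.
rewrite in_itv /= => hz e.
have : 0 <= f1 z * (y - x) by apply: mulr_ge0; [apply: f0; rewrite ltr_norml|]; lra.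
lra.
Qed.

Lemma zero_derive_const (f f1 : R -> R) x y : continuous f ->
  (forall z, `|z| < b -> is_derive z 1 f (f1 z)) -> (forall z, `|z| < b -> f1 z = 0) ->
  `|x| <= b -> `|y| <= b -> f x = f y.
Proof.
have bg := b_gt0.
move=> cf df f0; wlog xy : x y / x <= y.
  by move=> wl xb yb; have [xy|/ltW yx] := leP x y; [|apply/esym]; exact: wl.
rewrite !ler_norml => xb yb; apply/le_anti/andP; split.
  by apply: (@ge0_derive_le f f1) => //; [move=> z /f0 ->|lra|lra].
have := @ge0_derive_le (fun z => - f z) (fun z => - f1 z) x y.
rewrite lerN2; apply; [by cont|by move=> z /df d; derive_with|by move=> z /f0 ->; rewrite oppr0|lra|lra|lra].
Qed.

(** The two Wronskians of a solution with [cos (k y)] and [sin (k y)] are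
    constant; comparing them at both ends kills the odd part of the solution,
    and also the even part unless [cos (k y)] satisfies the Robin condition. *)
Lemma robin_ode k (c c1 : R -> R) : k != 0 -> continuous c -> continuous c1 ->
  (forall y, `|y| < b -> is_derive y 1 c (c1 y)) ->
  (forall y, `|y| < b -> is_derive y 1 c1 (- (k ^+ 2) * c y)) ->
  c1 b = - h * c b -> c1 (- b) = h * c (- b) ->
  h * sin (k * b) + k * cos (k * b) != 0 ->
  exists2 C, (h * cos (k * b) - k * sin (k * b) != 0 -> C = 0) &
    forall y, `|y| <= b -> c y = C * cos (k * y).
Proof.
have bg := b_gt0.
move=> k0 cc cc1 dc dc1 rb lb d2.
pose W1 y := c1 y * cos (k * y) + k * (c y * sin (k * y)).
pose W2 y := c1 y * sin (k * y) - k * (c y * cos (k * y)).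
have cW1 : continuous W1 by rewrite /W1; cont.
have cW2 : continuous W2 by rewrite /W2; cont.
have dW1 z : `|z| < b -> is_derive z 1 W1 0.
  by move=> zb; have e1 := dc z zb; have e2 := dc1 z zb; rewrite /W1; derive_with; ring.
have dW2 z : `|z| < b -> is_derive z 1 W2 0.
  by move=> zb; have e1 := dc z zb; have e2 := dc1 z zb; rewrite /W2; derive_with; ring.
have bb : `|b| <= b by rewrite gtr0_norm.
have bNb : `|- b| <= b by rewrite normrN.
have K1 y : `|y| <= b -> W1 y = W1 b by move=> yb; apply: (zero_derive_const cW1 dW1).
have K2 y : `|y| <= b -> W2 y = W2 b by move=> yb; apply: (zero_derive_const cW2 dW2).
have E1 := K1 _ bNb; have E2 := K2 _ bNb.
have W1b : W1 b = - (c b * (h * cos (k * b) - k * sin (k * b))) by rewrite /W1 rb; ring.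
have W2b : W2 b = - (c b * (h * sin (k * b) + k * cos (k * b))) by rewrite /W2 rb; ring.
have W1Nb : W1 (- b) = c (- b) * (h * cos (k * b) - k * sin (k * b)).
  by rewrite /W1 lb mulrN cosN sinN; ring.
have W2Nb : W2 (- b) = - (c (- b) * (h * sin (k * b) + k * cos (k * b))).
  by rewrite /W2 lb mulrN cosN sinN; ring.
have ceq : c (- b) = c b.
  by move: E2; rewrite W2Nb W2b => /oppr_inj /(mulIf d2).
have W10 : W1 b = 0 by move: E1; rewrite W1Nb W1b ceq; lra.
exists (- W2 b / k).
  move=> d1; have : c b = 0.
    move: W10; rewrite W1b => /eqP; rewrite oppr_eq0 mulf_eq0 (negbTE d1) orbF => /eqP //.
  by rewrite W2b => ->; rewrite mul0r oppr0 oppr0 mul0r.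
move=> y yb; apply: (mulfI k0).
have -> : k * c y = W1 y * sin (k * y) - W2 y * cos (k * y).
  rewrite /W1 /W2; have := cos2Dsin2 (k * y).
  move: (sin (k * y)) (cos (k * y)) (c y) (c1 y) => S C u v e.
  have -> : (v * C + k * (u * S)) * S - (v * S - k * (u * C)) * C = k * u * (C ^+ 2 + S ^+ 2) by ring.
  by rewrite e mulr1.
rewrite K1 // K2 // W10; field; exact: k0.
Qed.

End RobinODE.

(** * Solutions are combinations of two products *)

Section Rigidity.
Variable R : realType.
Variables (h : R) (s : nat -> R).
Hypothesis h_large : h_threshold R < h.
Hypothesis s_angle : forall j, (j <= 2)%N -> robin_angle j h (s j).
Let b : R := pi / 2.
Implicit Types (U Ux Uy Uxx Uyy : R * R -> R) (a x y lam : R).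
Local Notation k0 := (freq s 0).
Local Notation k1 := (freq s 1).
Local Notation k2 := (freq s 2).
Local Notation lam := (lam02 s).

(** A solution in a form adapted to integration over slices: the function and
    its gradient are continuous up to the boundary and extended continuously to
    the plane, while second derivatives exist only inside. *)
Record robin_solution U Ux Uy Uxx Uyy : Prop := RobinSolution {
  sol_cont : continuous U;
  sol_contx : continuous Ux;
  sol_conty : continuous Uy;
  sol_contxx : forall x y, open_box b x y -> {for (x, y), continuous Uxx};
  sol_contyy : forall x y, open_box b x y -> {for (x, y), continuous Uyy};
  sol_dx : forall x y, open_box b x y -> is_derive x 1 (fun x => U (x, y)) (Ux (x, y));
  sol_dy : forall x y, open_box b x y -> is_derive y 1 (fun y => U (x, y)) (Uy (x, y));
  sol_dxx : forall x y, open_box b x y -> is_derive x 1 (fun x => Ux (x, y)) (Uxx (x, y));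
  sol_dyy : forall x y, open_box b x y -> is_derive y 1 (fun y => Uy (x, y)) (Uyy (x, y));
  sol_pde : forall x y, open_box b x y -> Uxx (x, y) + Uyy (x, y) = - lam * U (x, y);
  sol_right : forall y, `|y| <= b -> Ux (b, y) = - h * U (b, y);
  sol_left : forall y, `|y| <= b -> Ux (- b, y) = h * U (- b, y);
  sol_top : forall x, `|x| <= b -> Uy (x, b) = - h * U (x, b);
  sol_bottom : forall x, `|x| <= b -> Uy (x, - b) = h * U (x, - b) }.

Lemma robin_solution_sub U Ux Uy Uxx Uyy V Vx Vy Vxx Vyy (c : R) :
  robin_solution U Ux Uy Uxx Uyy -> robin_solution V Vx Vy Vxx Vyy ->
  robin_solution (fun p => U p - c * V p) (fun p => Ux p - c * Vx p) (fun p => Uy p - c * Vy p)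
    (fun p => Uxx p - c * Vxx p) (fun p => Uyy p - c * Vyy p).
Proof.
move=> [u1 u2 u3 u4 u5 u6 u7 u8 u9 u10 u11 u12 u13 u14] [v1 v2 v3 v4 v5 v6 v7 v8 v9 v10 v11 v12 v13 v14].
have contB (f g : R * R -> R) p : {for p, continuous f} -> {for p, continuous g} ->
    {for p, continuous (fun p => f p - c * g p)}.
  by move=> cf cg; apply: cvgB => //; apply: cvgM => //; exact: cvg_cst.
split; try by cont.
- by move=> x y hxy; apply: contB; [exact: u4|exact: v4].
- by move=> x y hxy; apply: contB; [exact: u5|exact: v5].
- by move=> x y hxy; have d1 := u6 x y hxy; have d2 := v6 x y hxy; derive_with; ring.
- by move=> x y hxy; have d1 := u7 x y hxy; have d2 := v7 x y hxy; derive_with; ring.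
- by move=> x y hxy; have d1 := u8 x y hxy; have d2 := v8 x y hxy; derive_with; ring.
- by move=> x y hxy; have d1 := u9 x y hxy; have d2 := v9 x y hxy; derive_with; ring.
- move=> x y hxy; have e1 := u10 x y hxy; have e2 := v10 x y hxy.
  transitivity ((Uxx (x, y) + Uyy (x, y)) - c * (Vxx (x, y) + Vyy (x, y))); first by ring.
  by rewrite e1 e2; ring.
- by move=> y hy; rewrite u11 // v11 //; ring.
- by move=> y hy; rewrite u12 // v12 //; ring.
- by move=> y hy; rewrite u13 // v13 //; ring.
- by move=> y hy; rewrite u14 // v14 //; ring.
Qed.

Lemma product_solution k k' (u u1 v v1 : R -> R) : mode b h k u u1 -> mode b h k' v v1 ->
  k ^+ 2 + k' ^+ 2 = lam ->
  robin_solution (fun p => u p.1 * v p.2) (fun p => u1 p.1 * v p.2) (fun p => u p.1 * v1 p.2)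
    (fun p => - (k ^+ 2) * (u p.1 * v p.2)) (fun p => - (k' ^+ 2) * (u p.1 * v p.2)).
Proof.
move=> mu mv kk.
have cu := mode_cont mu; have cu1 := mode_cont1 mu.
have cv := mode_cont mv; have cv1 := mode_cont1 mv.
have c1 f : continuous f -> continuous (fun p : R * R => f p.1 : R).
  by move=> cf; apply: cont_comp => //; cont.
have c2 f : continuous f -> continuous (fun p : R * R => f p.2 : R).
  by move=> cf; apply: cont_comp => //; cont.
have cuv : continuous (fun p : R * R => u p.1 * v p.2) by apply: contM; [exact: c1|exact: c2].
have cK (z : R) : continuous (fun p : R * R => z * (u p.1 * v p.2)).
  by apply: contM => //; cont.
split => /=.
- exact: cuv.
- by apply: contM; [exact: c1|exact: c2].
- by apply: contM; [exact: c1|exact: c2].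
- by move=> x y _; exact: cK.
- by move=> x y _; exact: cK.
- by move=> x y _; have d := mode_der mu x; derive_with; ring.
- by move=> x y _; have d := mode_der mv y; derive_with; ring.
- by move=> x y _; have d := mode_der1 mu x; derive_with; ring.
- by move=> x y _; have d := mode_der1 mv y; derive_with; ring.
- by move=> x y _; rewrite -kk; ring.
- by move=> y _; rewrite (mode_right mu); ring.
- by move=> y _; rewrite (mode_left mu); ring.
- by move=> y _; rewrite (mode_right mv); ring.
- by move=> y _; rewrite (mode_left mv); ring.
Qed.

Section Slices.
Variables (U Ux Uy Uxx Uyy : R * R -> R).
Hypothesis solU : robin_solution U Ux Uy Uxx Uyy.

Lemma slice_C1 y : `|y| < b -> C1_inside b (fun x => U (x, y)) (fun x => Ux (x, y)).
Proof.
move=> yb; split; [apply: slice_cont1; exact: sol_cont solU|apply: slice_cont1; exact: sol_contx solU|].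
move=> x hx; apply: (sol_dx solU); split => //; rewrite ltr_norml; lra.
Qed.

(** Substituting the equation for [Uyy] and integrating by parts moves [Uxx] to the
    mode; the boundary terms cancel because both factors satisfy the Robin condition. *)
Lemma coefficient_ode k (u u1 : R -> R) : mode b h k u u1 ->
  let c y := integ (- b) b (fun x => U (x, y) * u x) in
  let c1 y := integ (- b) b (fun x => Uy (x, y) * u x) in
  [/\ continuous c, continuous c1,
      forall y, `|y| < b -> is_derive y 1 c (c1 y)
    & forall y, `|y| < b -> is_derive y 1 c1 (- (lam - k ^+ 2) * c y)].
Proof.
move=> m c c1; have b0 : 0 < b := pihalf_gt0 R.
have cu := mode_cont m; have cu1 := mode_cont1 m.
have [cU cUx cUy cUxx cUyy dx dy dxx dyy pde r1 r2 r3 r4] := solU.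
have cf f : continuous f -> continuous (fun p : R * R => f p.1 : R).
  by move=> cf; apply: cont_comp => //; cont.
have cV : continuous (fun p : R * R => U p * u p.1) by apply: contM => //; exact: cf.
have cVy : continuous (fun p : R * R => Uy p * u p.1) by apply: contM => //; exact: cf.
have nbb : - b <= b by lra.
split.
- exact: (integ_slice_continuous nbb cV).
- exact: (integ_slice_continuous nbb cVy).
- move=> y yb; apply: (slice_integ_derive b0 cV cVy _ yb) => x z hxz.
  by have d := dy x z hxz; rewrite /=; derive_with; ring.
- move=> y yb.
  pose W (p : R * R) := - (lam - k ^+ 2) * (U p * u p.1).
  pose P (p : R * R) := - (Ux p * u p.1 - U p * u1 p.1).
  pose Q (p : R * R) := Ux p * u p.1 - U p * u1 p.1.
  pose Vyy (p : R * R) := Uyy p * u p.1.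
  have cQ : continuous Q by apply: contD; [|apply: contN]; apply: contM => //; exact: cf.
  have cP : continuous P by exact: contN.
  have cW : continuous W by apply: contM => //; cont.
  have H := @slice_integ_derive2 R b b0 (fun p => Uy p * u p.1) Vyy W P Q y cVy.
  have -> : - (lam - k ^+ 2) * c y = integ (- b) b (fun x => W (x, y)) + (P (b, y) + Q (- b, y)).
    rewrite /c -integZ; last by apply: cont_within; exact: slice_cont1 cV.
    rewrite /P /Q /= (mode_right m) (mode_left m) r1 ?r2 ?(ltW yb) //.
    by rewrite -[LHS]addr0; congr (_ + _); ring.
  apply: H => //.
  + move=> x z hxz; apply: cvgM; first exact: cUyy.
    exact: (cf u cu (x, z)).
  + by move=> x z hxz; have d := dyy x z hxz; rewrite /Vyy /=; derive_with; ring.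
  + move=> a z /andP[a0 ab] zb.
    have aa : - a < a by lra.
    have inb x : - a <= x <= a -> open_box b x z.
      by move=> hx; split => //; rewrite ltr_norml; lra.
    have cwU : {within `[- a, a], continuous (fun x => Uxx (x, z))}.
      apply: continuous_in_subspaceT => x /set_mem /=; rewrite in_itv /= => /inb hx.
      by apply: (@continuous_comp _ _ _ (fun x => (x, z)) Uxx); [apply: cont_pair; cont|exact: cUxx].
    have cw (f : R -> R) : continuous f -> {within `[- a, a], continuous f} by exact: cont_within.
    have sU := slice_cont1 z cU; have sUx := slice_cont1 z cUx.
    have parts := @integ_ftc R (- a) a (fun x => Uxx (x, z) * u x + k ^+ 2 * (U (x, z) * u x))
       (fun x => Ux (x, z) * u x - U (x, z) * u1 x) aa.
    have cUu : {within `[- a, a], continuous (fun x => U (x, z) * u x)} by apply: cw; cont.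
    have cUu' : {within `[- a, a], continuous (fun x => k ^+ 2 * (U (x, z) * u x))} by apply: cw; cont.
    have cUxxu : {within `[- a, a], continuous (fun x => Uxx (x, z) * u x)}.
      by move=> x; apply: cvgM; [exact: cwU|exact: (cw u)].
    have {}parts : integ (- a) a (fun x => Uxx (x, z) * u x + k ^+ 2 * (U (x, z) * u x)) =
       Q (a, z) - Q (- a, z).
      apply: parts.
      * by move=> x; apply: cvgD; [exact: cUxxu|exact: cUu'].
      * by apply: cw; cont.
      * move=> x hx; have hx' : open_box b x z by apply: inb; lra.
        have d1 := dx x z hx'; have d2 := dxx x z hx'; have d3 := mode_der m x; have d4 := mode_der1 m x.
        by derive_with; ring.
    have -> : integ (- a) a (fun x => Vyy (x, z)) =
      integ (- a) a (fun x => W (x, z) - (Uxx (x, z) * u x + k ^+ 2 * (U (x, z) * u x))).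
      apply: eq_integ => x /inb hx; rewrite /Vyy /W /=.
      have e : Uyy (x, z) = - lam * U (x, z) - Uxx (x, z) by have := pde x z hx; lra.
      by rewrite e; ring.
    rewrite integB.
    * by rewrite parts /P /Q /=; ring.
    * by apply: cw; exact: slice_cont1.
    * by move=> x; apply: cvgD; [exact: cUxxu|exact: cUu'].
Qed.

Lemma coefficient_cos k (u u1 : R -> R) kap : mode b h k u u1 -> kap != 0 ->
  kap ^+ 2 = lam - k ^+ 2 -> h * sin (kap * b) + kap * cos (kap * b) != 0 ->
  exists2 C, (h * cos (kap * b) - kap * sin (kap * b) != 0 -> C = 0) &
    forall y, `|y| <= b -> integ (- b) b (fun x => U (x, y) * u x) = C * cos (kap * y).
Proof.
move=> m kap0 kapE d2; have b0 : 0 < b := pihalf_gt0 R.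
have [cc cc1 dc dc1] := coefficient_ode m.
rewrite -kapE in dc1.
have cu := mode_cont m; have cU := sol_cont solU.
have bc y z : (forall x, `|x| <= b -> Uy (x, y) = z * U (x, y)) ->
    integ (- b) b (fun x => Uy (x, y) * u x) = z * integ (- b) b (fun x => U (x, y) * u x).
  move=> H; rewrite -integZ; last by apply: cont_within; have := slice_cont1 y cU => ?; cont.
  by apply: eq_integ => x hx; rewrite H ?ler_norml // mulrA.
apply: (robin_ode b0 kap0 cc cc1 dc dc1) => //; apply: bc.
- exact: sol_top solU.
- exact: sol_bottom solU.
Qed.

(** Substituting the equation for [Uyy] and integrating by parts in [x] produces the
    Robin form of the slice; its sign decides convexity of the squared norm. *)
Lemma slice_norm_ode :
  let G y := integ (- b) b (fun x => U (x, y) ^+ 2) in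
  let G1 y := integ (- b) b (fun x => 2 * (U (x, y) * Uy (x, y))) in
  [/\ continuous G, continuous G1,
      forall y, `|y| < b -> is_derive y 1 G (G1 y)
    & forall y, `|y| < b -> is_derive y 1 G1 (2 * (integ (- b) b (fun x => Uy (x, y) ^+ 2) +
        robin_form b h lam (fun x => U (x, y)) (fun x => Ux (x, y))))].
Proof.
move=> G G1; have b0 : 0 < b := pihalf_gt0 R.
have [cU cUx cUy cUxx cUyy dx dy dxx dyy pde r1 r2 r3 r4] := solU.
have cV : continuous (fun p : R * R => U p ^+ 2) by cont.
have cVy : continuous (fun p : R * R => 2 * (U p * Uy p)) by cont.
have nbb : - b <= b by lra.
split.
- exact: (integ_slice_continuous nbb cV).
- exact: (integ_slice_continuous nbb cVy).
- move=> y yb; apply: (slice_integ_derive b0 cV cVy _ yb) => x z hxz.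
  by have d := dy x z hxz; rewrite /=; derive_with; ring.
- move=> y yb.
  pose W (p : R * R) := 2 * (Uy p ^+ 2) + 2 * (Ux p ^+ 2 - lam * U p ^+ 2).
  pose P (p : R * R) := - (2 * (U p * Ux p)).
  pose Q (p : R * R) := 2 * (U p * Ux p).
  pose Vyy (p : R * R) := 2 * (Uy p * Uy p + U p * Uyy p).
  have cQ : continuous Q by rewrite /Q; cont.
  have cP : continuous P by rewrite /P; cont.
  have cW : continuous W by rewrite /W; cont.
  have H := @slice_integ_derive2 R b b0 (fun p => 2 * (U p * Uy p)) Vyy W P Q y cVy.
  have sl (V : R * R -> R) z : continuous V -> continuous (fun x => V (x, z)).
    by move=> ?; exact: slice_cont1.
  have -> : 2 * (integ (- b) b (fun x => Uy (x, y) ^+ 2) +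
        robin_form b h lam (fun x => U (x, y)) (fun x => Ux (x, y))) =
      integ (- b) b (fun x => W (x, y)) + (P (b, y) + Q (- b, y)).
    have s1 := sl _ y cU; have s2 := sl _ y cUx; have s3 := sl _ y cUy.
    rewrite /W integD; try by (apply: cont_within; cont).
    rewrite !integZ; try by (apply: cont_within; cont).
    rewrite /P /Q /robin_form r1 ?r2 ?(ltW yb) //.
    by ring.
  apply: H => //.
  + move=> x z hxz; apply: cvgM; first exact: cvg_cst.
    apply: cvgD; first by apply: cvgM; exact: cUy.
    by apply: cvgM; [exact: cU|exact: cUyy].
  + move=> x z hxz; have d := dyy x z hxz; have d' := dy x z hxz.
    by rewrite /Vyy /=; derive_with; ring.
  + move=> a z /andP[a0 ab] zb.
    have aa : - a < a by lra.
    have inb x : - a <= x <= a -> open_box b x z.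
      by move=> hx; split => //; rewrite ltr_norml; lra.
    have cwU : {within `[- a, a], continuous (fun x => Uxx (x, z))}.
      apply: continuous_in_subspaceT => x /set_mem /=; rewrite in_itv /= => /inb hx.
      by apply: (@continuous_comp _ _ _ (fun x => (x, z)) Uxx); [apply: cont_pair; cont|exact: cUxx].
    have cw (f : R -> R) : continuous f -> {within `[- a, a], continuous f} by exact: cont_within.
    have sU := slice_cont1 z cU; have sUx := slice_cont1 z cUx.
    have cUU : {within `[- a, a], continuous (fun x => U (x, z) * Uxx (x, z))}.
      by move=> x; apply: cvgM; [exact: (cw _ sU)|exact: cwU].
    have cD : {within `[- a, a], continuous (fun x => 2 * (Ux (x, z) * Ux (x, z) + U (x, z) * Uxx (x, z)))}.
      move=> x; apply: cvgM; first exact: cvg_cst.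
      by apply: cvgD; [apply: cvgM; exact: (cw _ sUx)|exact: cUU].
    have parts : integ (- a) a (fun x => 2 * (Ux (x, z) * Ux (x, z) + U (x, z) * Uxx (x, z))) =
       Q (a, z) - Q (- a, z).
      apply: (@integ_ftc R (- a) a _ (fun x => 2 * (U (x, z) * Ux (x, z)))) => //.
      * by apply: cw; cont.
      * move=> x hx; have hx' : open_box b x z by apply: inb; lra.
        have d1 := dx x z hx'; have d2 := dxx x z hx'.
        by derive_with; ring.
    have -> : integ (- a) a (fun x => Vyy (x, z)) =
      integ (- a) a (fun x => W (x, z) - 2 * (Ux (x, z) * Ux (x, z) + U (x, z) * Uxx (x, z))).
      apply: eq_integ => x /inb hx; rewrite /Vyy /W /=.
      have e : Uyy (x, z) = - lam * U (x, z) - Uxx (x, z) by have := pde x z hx; lra.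
      by rewrite e; ring.
    rewrite integB.
    * by rewrite parts /P /Q /=; ring.
    * by apply: cw; exact: slice_cont1.
    * exact: cD.
Qed.

(** By [slice_norm_ode] the squared norm of a slice is convex, whereas the Robin
    conditions at the top and at the bottom give its derivative the opposite signs. *)
Lemma orthogonal_solution_eq0 :
  (forall y, `|y| < b ->
     [/\ integ (- b) b (fun x => U (x, y) * cos (k0 * x)) = 0,
         integ (- b) b (fun x => U (x, y) * sin (k1 * x)) = 0
       & integ (- b) b (fun x => U (x, y) * cos (k2 * x)) = 0]) ->
  forall x y, open_box b x y -> U (x, y) = 0.
Proof.
move=> orth; have b0 : 0 < b := pihalf_gt0 R.
have [] := slice_norm_ode.
set G := (fun y => integ _ _ _); set G1 := (fun y => integ _ _ _) => cG cG1 dG dG1.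
have pos y : `|y| < b -> 0 <= 2 * (integ (- b) b (fun x => Uy (x, y) ^+ 2) +
        robin_form b h lam (fun x => U (x, y)) (fun x => Ux (x, y))).
  move=> yb; have [q0 q1 q2] := orth y yb.
  apply: mulr_ge0 => //; apply: addr_ge0; first by apply: integ_ge0 => x _; exact: sqr_ge0.
  by apply: robin_form_ge0 => //; exact: slice_C1.
have G1_le y z : - b <= y -> y <= z -> z <= b -> G1 y <= G1 z.
  exact: (ge0_derive_le b0 cG1 dG1 pos).
have G_ge0 y : 0 <= G y by apply: integ_ge0 => x _; exact: sqr_ge0.
have cU := sol_cont solU.
have G1bc y z : (forall x, `|x| <= b -> Uy (x, y) = z * U (x, y)) -> G1 y = 2 * z * G y.
  move=> H; rewrite /G /G1 -integZ; last first.
    by apply: cont_within; have := slice_cont1 y cU => ?; cont.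
  by apply: eq_integ => x hx; rewrite H ?ler_norml //; ring.
have h0 := h_gt0 h_large.
have Gt := G1bc b (- h) (sol_top solU).
have Gl := G1bc (- b) h (sol_bottom solU).
have nbb : - b <= b by lra.
have le1 := G1_le (- b) b (lexx _) nbb (lexx _).
have p1 : 0 <= h * G b by apply: mulr_ge0 => //; exact: ltW.
have p2 : 0 <= h * G (- b) by apply: mulr_ge0 => //; exact: ltW.
have Gb0 : h * G b = 0 by move: le1; rewrite Gt Gl; lra.
have GNb0 : h * G (- b) = 0 by move: le1; rewrite Gt Gl; lra.
have G1b0 : G1 b = 0 by rewrite Gt; lra.
have G1Nb0 : G1 (- b) = 0 by rewrite Gl; lra.
have G10 y : `|y| < b -> G1 y = 0.
  rewrite ltr_norml => hy; apply/le_anti/andP; split.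
    by rewrite -G1b0; apply: G1_le; lra.
  by rewrite -[leLHS]G1Nb0; apply: G1_le; lra.
have Gy0 y : `|y| < b -> G y = 0.
  move=> yb; have -> : G y = G b.
    by apply: (zero_derive_const b0 cG dG G10); rewrite ?(gtr0_norm b0) // ltW.
  by move/eqP: Gb0; rewrite mulf_eq0 gt_eqF //= => /eqP.
move=> x y [xb yb]; have := @integ_eq0 R (- b) b (fun x => U (x, y) ^+ 2) _ _ (Gy0 y yb) x.
move=> H; apply/eqP; rewrite -[_ == 0](sqrf_eq0 (U (x, y))); apply/eqP; apply: H.
- by have := slice_cont1 y cU => ?; cont.
- by move=> z; exact: sqr_ge0.
- by rewrite -ltr_norml.
Qed.

End Slices.

(** A cosine mode and a sine mode cannot share their frequency. *)
Lemma robin_nonresonant k : k * sin (k * b) = h * cos (k * b) ->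
  h * sin (k * b) + k * cos (k * b) != 0.
Proof.
move=> e; have h0 := h_gt0 h_large; apply/eqP => e2.
have c0 : cos (k * b) = 0.
  have : (h ^+ 2 + k ^+ 2) * cos (k * b) = 0.
    have -> : (h ^+ 2 + k ^+ 2) * cos (k * b) = h * (h * cos (k * b)) + k * (k * cos (k * b)) by ring.
    by rewrite -e (_ : k * cos (k * b) = - (h * sin (k * b))); [ring|lra].
  move/eqP; rewrite mulf_eq0 gt_eqF /=; last by rewrite ltr_wpDr ?sqr_ge0 // exprn_gt0.
  by move/eqP.
have s0 : sin (k * b) = 0.
  by move: e2; rewrite c0 mulr0 addr0 => /eqP; rewrite mulf_eq0 gt_eqF //= => /eqP.
by have := cos2Dsin2 (k * b); rewrite c0 s0 expr0n /= addr0; lra.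
Qed.

(** The complementary frequency is close to [sqrt 6]: [kap * b] lies between
    [pi + margin] and [3 / 2 * pi - margin], where for large [h] neither Robin
    equation has a root. *)
Lemma middle_frequency : exists kap : R, [/\ kap != 0, kap ^+ 2 = lam - k1 ^+ 2,
  h * sin (kap * b) + kap * cos (kap * b) != 0 &
  h * cos (kap * b) - kap * sin (kap * b) != 0].
Proof.
have p0 := pi_gt0 R.
have b0 := freq_bounds h_large s_angle (isT : (0 <= 2)%N).
have b1 := freq_bounds h_large s_angle (isT : (1 <= 2)%N).
have b2 := freq_bounds h_large s_angle (isT : (2 <= 2)%N).
pose v := lam - k1 ^+ 2.
have v1 : (17 / 8) ^+ 2 <= v by rewrite /v /lam02; move: b0 b1 b2; move: k0 k1 k2 => x y z; nra.
have v2 : v <= (23 / 8) ^+ 2 by rewrite /v /lam02; move: b0 b1 b2; move: k0 k1 k2 => x y z; nra.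
have v0 : 0 <= v by apply: le_trans v1; exact: sqr_ge0.
pose kap := Num.sqrt v.
have kv : kap ^+ 2 = v by rewrite /kap sqr_sqrtr.
have kap0 : 0 <= kap by exact: sqrtr_ge0.
have k1' : 17 / 8 <= kap by rewrite -(@ler_pXn2r _ 2) ?nnegrE ?kv //; lra.
have k2' : kap <= 23 / 8 by rewrite -(@ler_pXn2r _ 2) ?nnegrE ?kv //; lra.
exists kap.
have [t [ht ek]] : exists t, margin R <= t <= pi / 2 - margin R /\ kap * b = pi / 2 - t + pi.
  exists (3 / 2 * pi - kap * b); split; last by lra.
  have q1 : 17 / 8 * b <= kap * b by rewrite ler_pM2r // /b; lra.
  have q2 : kap * b <= 23 / 8 * b by rewrite ler_pM2r // /b; lra.
  by move: q1 q2; rewrite /margin /b; lra.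
have m0 := margin_gt0 R; have hl := lt_h_thresholdP h_large; have h0 := h_gt0 h_large.
have ms := sin_margin_gt0 R; have mc := cos_margin_gt0 R.
have st : sin (margin R) <= sin t by apply: sin_le_pihalf; lra.
have ct : cos t <= cos (margin R) by apply: cos_le_pihalf; lra.
have ct0 : 0 < cos t by apply: cos_gt0_pihalf; lra.
have k00 : kap != 0 by rewrite gt_eqF //; lra.
have sE : sin (kap * b) = - cos t.
  by rewrite ek sinDpi sinB sin_pihalf cos_pihalf; lra.
have cE : cos (kap * b) = - sin t.
  by rewrite ek cosDpi cosB sin_pihalf cos_pihalf; lra.
have hs : h * sin (margin R) <= h * sin t by rewrite ler_pM2l.
have kc : kap * cos t <= 3 * cos (margin R) by apply: ler_pM; lra.
split => //; rewrite sE cE.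
- rewrite lt_eqF // !mulrN -opprD oppr_lt0; apply: addr_gt0; apply: mulr_gt0 => //; lra.
- rewrite lt_eqF // !mulrN opprK; lra.
Qed.

(** The two coefficients are those along the modes 0 and 2; what is left after
    subtracting the products is orthogonal to the three modes. *)
Lemma robin_solution_family U Ux Uy Uxx Uyy : robin_solution U Ux Uy Uxx Uyy ->
  exists a, exists c, forall x y, open_box b x y ->
    U (x, y) = a * (cos (k0 * x) * cos (k2 * y)) + c * (cos (k2 * x) * cos (k0 * y)).
Proof.
move=> solU; have b0 : 0 < b := pihalf_gt0 R; have hb : b = pi / 2 by [].
have m0 := mode0 s_angle; have m1 := mode1 s_angle; have m2 := mode2 s_angle.
have f0 := freq_bounds h_large s_angle (isT : (0 <= 2)%N).
have f1 := freq_bounds h_large s_angle (isT : (1 <= 2)%N).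
have f2 := freq_bounds h_large s_angle (isT : (2 <= 2)%N).
have k0n : k0 != 0 by rewrite gt_eqF //; lra.
have k2n : k2 != 0 by rewrite gt_eqF //; lra.
have n0 : h * sin (k0 * b) + k0 * cos (k0 * b) != 0.
  by apply: robin_nonresonant; have := mode_right m0; rewrite !mulNr => /oppr_inj.
have n2 : h * sin (k2 * b) + k2 * cos (k2 * b) != 0.
  by apply: robin_nonresonant; have := mode_right m2; rewrite !mulNr => /oppr_inj.
have [kap [kap0 kapE n1 n1']] := middle_frequency.
have E2 : k2 ^+ 2 = lam - k0 ^+ 2 by rewrite /lam02; ring.
have E0 : k0 ^+ 2 = lam - k2 ^+ 2 by rewrite /lam02; ring.
have [C0 _ hC0] := coefficient_cos solU m0 k2n E2 n2.
have [C2 _ hC2] := coefficient_cos solU m2 k0n E0 n0.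
have [C1 hC1 hC1'] := coefficient_cos solU m1 kap0 kapE n1.
have C10 := hC1 n1'.
have n02 : k0 ^+ 2 != k2 ^+ 2 by rewrite lt_eqF //; move: f0 f2; move: k0 k2 => x y; nra.
have n01 : k0 ^+ 2 != k1 ^+ 2 by rewrite lt_eqF //; move: f0 f1; move: k0 k1 => x y; nra.
have n21 : k2 ^+ 2 != k1 ^+ 2 by rewrite gt_eqF //; move: f2 f1; move: k2 k1 => x y; nra.
have t02 := modes_orthogonal hb m0 m2 n02.
have n20 : k2 ^+ 2 != k0 ^+ 2 by rewrite eq_sym.
have t20 := modes_orthogonal hb m2 m0 n20.
have t01 := modes_orthogonal hb m0 m1 n01.
have t21 := modes_orthogonal hb m2 m1 n21.
pose N k := integ (- b) b (fun x => cos (k * x) * cos (k * x)).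
have Nn k : N k != 0.
  apply/eqP => Nk.
  have := @integ_eq0 R (- b) b (fun x => cos (k * x) * cos (k * x)) _ _ Nk 0.
  have H1 : continuous (fun x : R => cos (k * x) * cos (k * x)) by cont.
  have H2 (x : R) : 0 <= cos (k * x) * cos (k * x) by rewrite -expr2 sqr_ge0.
  move=> /(_ H1 H2); rewrite mulr0 cos0 mulr1 => H.
  have : 1 = 0 :> R by apply: H; lra.
  by move/eqP; rewrite oner_eq0.
exists (C0 / N k0), (C2 / N k2).
have e20 : k2 ^+ 2 + k0 ^+ 2 = lam by rewrite addrC.
have solA := product_solution m0 m2 (erefl lam).
have solB := product_solution m2 m0 e20.
have sol1 := robin_solution_sub (C0 / N k0) solU solA.
have sol2 := robin_solution_sub (C2 / N k2) sol1 solB.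
have cU := sol_cont solU.
have expand (u : R -> R) y : continuous u ->
    integ (- b) b (fun x => (U (x, y) - C0 / N k0 * (cos (k0 * x) * cos (k2 * y))
       - C2 / N k2 * (cos (k2 * x) * cos (k0 * y))) * u x) =
    integ (- b) b (fun x => U (x, y) * u x)
      - C0 / N k0 * cos (k2 * y) * integ (- b) b (fun x => cos (k0 * x) * u x)
      - C2 / N k2 * cos (k0 * y) * integ (- b) b (fun x => cos (k2 * x) * u x).
  move=> cu; have sU := slice_cont1 y cU.
  rewrite -!integZ; try by (apply: cont_within; cont).
  rewrite -!integB; try by (apply: cont_within; cont).
  by apply: eq_integ => x _; ring.
have Z := orthogonal_solution_eq0 sol2.
move=> x y xy; suff : U (x, y) - C0 / N k0 * (cos (k0 * x) * cos (k2 * y))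
       - C2 / N k2 * (cos (k2 * x) * cos (k0 * y)) = 0 by lra.
apply: Z xy => {x}y /ltW yb /=; split.
- rewrite expand; last by cont.
  rewrite hC0 // -/(N k0) t20; move: (N k0) (Nn k0) (N k2) (Nn k2) => n nn n' nn'.
  by field; rewrite nn nn'.
- rewrite expand; last by cont.
  by rewrite hC1' // C10 t01 t21; ring.
- rewrite expand; last by cont.
  rewrite hC2 // -/(N k2) t02; move: (N k0) (Nn k0) (N k2) (Nn k2) => n nn n' nn'.
  by field; rewrite nn nn'.
Qed.

End Rigidity.

(** * Extension of eigenfunctions to the closed square *)

Section Extension.
Variable R : realType.
Implicit Types (u v : R * R -> R) (p q : R * R) (x y z eps : R).
Let b : R := pi / 2.
Local Notation sq := (square (R := R)).

Lemma square_box p : square p <-> open_box b p.1 p.2.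
Proof. exact: square_normP. Qed.

(** The nearest point of the segment, written without comparisons so that continuity
    is immediate. *)
Definition clamp x : R := (`|x + b| - `|x - b|) / 2.

Lemma clamp_id x : `|x| <= b -> clamp x = x.
Proof.
rewrite ler_norml /clamp => hx; rewrite ger0_norm ?ler0_norm; lra.
Qed.

Lemma clamp_le x : `|clamp x| <= b.
Proof.
have b0 : 0 < b := pihalf_gt0 R.
rewrite ler_norml /clamp; have [h1|h1] := leP 0 (x + b); have [h2|h2] := leP 0 (x - b).
- by rewrite !ger0_norm //; lra.
- by rewrite ger0_norm // ltr0_norm //; lra.
- by exfalso; lra.
- by rewrite !ltr0_norm //; lra.
Qed.

Definition clamp2 p : R * R := (clamp p.1, clamp p.2).

Lemma clamp2_continuous : continuous clamp2.
Proof. by rewrite /clamp2 /clamp; cont. Qed.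

Lemma closure_square p : `|p.1| <= b -> `|p.2| <= b -> closure sq p.
Proof.
have b0 : 0 < b := pihalf_gt0 R.
move=> h1 h2 A /nbhs_ballP[e /= e0 he].
pose t := Num.min (1 / 2) (e / (2 * b)).
have t0 : 0 < t by rewrite lt_min divr_gt0 //= divr_gt0 //; lra.
have t1 : t < 1 by rewrite gt_min; apply/orP; left; lra.
have te : t * b < e.
  have : t <= e / (2 * b) by rewrite ge_min lexx orbT.
  by rewrite ler_pdivlMr; [lra|lra].
have n1 (x : R) : `|x| <= b -> `|(1 - t) * x| < b.
  move=> xb; rewrite normrM gtr0_norm ?subr_gt0 //.
  have : (1 - t) * `|x| <= (1 - t) * b by rewrite ler_wpM2l //; lra.
  have := mulr_gt0 t0 b0; lra.
have n2 (x : R) : `|x| <= b -> `|x - (1 - t) * x| < e.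
  move=> xb; have -> : x - (1 - t) * x = t * x by ring.
  by rewrite normrM gtr0_norm //; apply: le_lt_trans te; rewrite ler_wpM2l // ltW.
exists ((1 - t) * p.1, (1 - t) * p.2); split; first by apply/square_box; split; exact: n1.
by apply: he; split; rewrite /ball /=; exact: n2.
Qed.

(** The continuous extension to the closed square, prolonged to the plane by
    composition with the projection on the closed square. *)
Definition extend v p : R := lim (v @ within sq (nbhs (clamp2 p))).

Fact clamp2_closure p : closure sq (clamp2 p).
Proof. by apply: closure_square; exact: clamp_le. Qed.

Fact within_clamp2_proper p : ProperFilter (within sq (nbhs (clamp2 p))).
Proof. exact/within_nbhs_proper/clamp2_closure. Qed.

Lemma extend_cvg v p : extends_to_closure v -> v @ within sq (nbhs (clamp2 p)) --> extend v p.
Proof. by move=> hv; apply: hv; exact: clamp2_closure. Qed.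

Lemma extend_lim v p l : v @ within sq (nbhs (clamp2 p)) --> l -> extend v p = l.
Proof. by move=> hl; have F := within_clamp2_proper p; exact: cvg_lim hl. Qed.

Lemma extend_continuous v : extends_to_closure v -> continuous (extend v).
Proof.
move=> hv p; apply/cvgrPdist_le => eps e0.
have e2 : 0 < eps / 2 by lra.
have := extend_cvg (p := p) hv => /cvgrPdist_lt/(_ _ e2).
rewrite /= /within /= => /nbhs_interior hI.
pose near_value r := sq r -> `|extend v p - v r| < eps / 2.
have hc : nbhs p (clamp2 @^-1` interior near_value) by exact: (clamp2_continuous hI).
apply: filterS hc => q hq.
have F := within_clamp2_proper q.
have /cvgrPdist_lt/(_ _ e2) h1 := extend_cvg (p := q) hv.
have h2 : within sq (nbhs (clamp2 q)) (fun r => `|extend v p - v r| < eps / 2).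
  exact: hq.
have [r [hr1 hr2]] := @filter_ex _ _ F _ (filterI h1 h2).
move: hr1 hr2; move: (extend v p) (extend v q) (v r) => X Y Z.
rewrite !ltr_norml ler_norml; lra.
Qed.

Lemma extend_eq v p : square p -> {for p, continuous v} -> extend v p = v p.
Proof.
move=> sp cv; apply: extend_lim.
have -> : clamp2 p = p.
  have [/ltW h1 /ltW h2] := (square_box p).1 sp.
  by rewrite /clamp2 !clamp_id //; case: p {sp cv h1 h2}.
exact: cvg_within_filter cv.
Qed.

Fact nbhs_square x y : open_box b x y -> nbhs (x, y) sq.
Proof. by move=> hxy; apply: open_nbhs_nbhs; split; [exact: open_square|exact/square_box]. Qed.

Fact near_square1 x y : open_box b x y -> \forall z \near x, square (z, y).
Proof.
move=> /nbhs_square hn; have c : continuous (fun z : R => (z, y)) by cont.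
exact: (c x sq hn).
Qed.

Fact near_square2 x y : open_box b x y -> \forall z \near y, square (x, z).
Proof.
move=> /nbhs_square hn; have c : continuous (fun z : R => (x, z)) by cont.
exact: (c y sq hn).
Qed.

Lemma is_derive_dirx v x y : derivable v (x, y) (dirx R) ->
  is_derive x 1 (fun z => v (z, y)) ('D_(dirx R) v (x, y)).
Proof.
have e : (fun k : R => k^-1 *: (v (k *: dirx R + (x, y)) - v (x, y))) =
         (fun k : R => k^-1 *: (v (k *: 1 + x, y) - v (x, y))).
  by apply/funext => k; congr (_ *: (v (_, _) - _)); rewrite /= /GRing.scale /= mulr0 add0r.
by move=> dv; apply: DeriveDef; rewrite /derivable /derive /= -e.
Qed.

Lemma is_derive_diry v x y : derivable v (x, y) (diry R) ->
  is_derive y 1 (fun z => v (x, z)) ('D_(diry R) v (x, y)).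
Proof.
have e : (fun k : R => k^-1 *: (v (k *: diry R + (x, y)) - v (x, y))) =
         (fun k : R => k^-1 *: (v (x, k *: 1 + y) - v (x, y))).
  by apply/funext => k; congr (_ *: (v (_, _) - _)); rewrite /= /GRing.scale /= mulr0 add0r.
by move=> dv; apply: DeriveDef; rewrite /derivable /derive /= -e.
Qed.

Lemma derive_opp_dir v p e : derivable v p e -> 'D_(- e) v p = - 'D_e v p.
Proof.
move=> dv; apply/cvg_lim => //.
have /cvgrPdist_le dv' : (fun k : R => k^-1 *: (v (k *: e + p) - v p)) @ 0^' --> 'D_e v p by exact: dv.
apply/cvgrPdist_le => eps e0.
have /nbhs_ballP[d /= d0 hd] := dv' _ e0.
apply/nbhs_ballP; exists d => //= k kd k0.
have := hd (- k); rewrite /ball /= !sub0r !normrN => /(_ _ _).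
move: kd; rewrite /ball /= sub0r normrN => kd /(_ kd).
rewrite oppr_eq0 => /(_ k0).
by rewrite scalerN scaleNr invrN scaleNr -opprD normrN opprK.
Qed.

Lemma extend_derive1 v x y d : C1_square v -> open_box b x y ->
  is_derive x 1 (fun z => v (z, y)) d -> is_derive x 1 (fun z => extend v (z, y)) d.
Proof.
move=> cv hxy; apply: near_eq_is_derive; apply: filterS (near_square1 hxy) => z sz.
by rewrite extend_eq //; case: (cv _ sz).
Qed.

Lemma extend_derive2 v x y d : C1_square v -> open_box b x y ->
  is_derive y 1 (fun z => v (x, z)) d -> is_derive y 1 (fun z => extend v (x, z)) d.
Proof.
move=> cv hxy; apply: near_eq_is_derive; apply: filterS (near_square2 hxy) => z sz.
by rewrite extend_eq //; case: (cv _ sz).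
Qed.

Lemma eq_closed_segment (f g : R -> R) : continuous f -> continuous g ->
  (forall x, `|x| < b -> f x = g x) -> forall x, `|x| <= b -> f x = g x.
Proof.
move=> cf cg fg x xb; have b0 : 0 < b := pihalf_gt0 R.
apply/eqP; rewrite -subr_eq0; apply/negPn/negP => ne.
have e0 : 0 < `|f x - g x| by rewrite normr_gt0.
have cd : continuous (fun x => f x - g x) by cont.
have /cvgrPdist_lt/(_ _ e0)/nbhs_ballP[d /= d0 hd] := cd x.
pose t := Num.min (1 / 2) (d / (2 * b)).
have t0 : 0 < t by rewrite lt_min divr_gt0 //= divr_gt0 //; lra.
have t1 : t < 1 by rewrite gt_min; apply/orP; left; lra.
have te : t * b < d.
  have : t <= d / (2 * b) by rewrite ge_min lexx orbT.
  by rewrite ler_pdivlMr; [lra|lra].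
have := hd ((1 - t) * x); rewrite (fg ((1 - t) * x)); last first.
  rewrite normrM gtr0_norm ?subr_gt0 //.
  have : (1 - t) * `|x| <= (1 - t) * b by rewrite ler_wpM2l //; lra.
  have := mulr_gt0 t0 b0; lra.
rewrite subrr subr0 ltxx => H; apply: (Bool.diff_false_true); apply: H.
rewrite /ball /=; have -> : x - (1 - t) * x = t * x by ring.
by rewrite normrM gtr0_norm //; apply: le_lt_trans te; rewrite ler_wpM2l // ltW.
Qed.

End Extension.

Section EigenfunctionToSolution.
Variable R : realType.
Variables (h : R) (s : nat -> R) (u : R * R -> R).
Let b : R := pi / 2.
Hypothesis eig : robin_eigenfunction h (lam02 s) u.
Local Notation ux := ('D_(dirx R) u).
Local Notation uy := ('D_(diry R) u).

(** Only the function and its gradient extend continuously, so the second derivatives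
    are those inside the square. *)
Lemma eigenfunction_solution : robin_solution h s (extend u) (extend ux) (extend uy)
  ('D_(dirx R) ux) ('D_(diry R) uy).
Proof.
have [[C1u [C1ux C1uy]] [_ eu eux euy] _ pde rob] := eig.
have b0 : 0 < b := pihalf_gt0 R.
have dx p : square p -> derivable u p (dirx R) by move=> sp; have [_ /(_ _ (or_introl erefl))[]] := C1u p sp.
have dy p : square p -> derivable u p (diry R) by move=> sp; have [_ /(_ _ (or_intror erefl))[]] := C1u p sp.
have dxx p : square p -> derivable ux p (dirx R) /\ {for p, continuous ('D_(dirx R) ux)}.
  by move=> sp; have [_ /(_ _ (or_introl erefl))] := C1ux p sp.
have dyy p : square p -> derivable uy p (diry R) /\ {for p, continuous ('D_(diry R) uy)}.
  by move=> sp; have [_ /(_ _ (or_intror erefl))] := C1uy p sp.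
have sqx x y : open_box b x y -> square (x, y) by move=> ?; apply/square_box.
have cE (v : R * R -> R) p : C1_square v -> square p -> extend v p = v p.
  by move=> cv sp; apply: extend_eq => //; case: (cv p sp).
have cu := extend_continuous eu; have cux := extend_continuous eux; have cuy := extend_continuous euy.
(* The Robin condition is the uniqueness of the limit of [v + h * u] at a side. *)
have side (v : R * R -> R) (q : R * R) (c : R) : `|q.1| <= b -> `|q.2| <= b -> extends_to_closure v ->
    (fun p => c * v p + h * u p) @ within (square (R:=R)) (nbhs q) --> (0 : R) ->
    c * extend v q + h * extend u q = 0.
  move=> q1 q2 ev hl.
  have qE : clamp2 q = q by rewrite /clamp2 !clamp_id //; case: q {q1 q2 hl}.
  have F := within_clamp2_proper q.
  have l1 := extend_cvg (p := q) ev; have l2 := extend_cvg (p := q) eu.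
  have l3 : (fun p => c * v p + h * u p) @ within (square (R:=R)) (nbhs (clamp2 q))
      --> c * extend v q + h * extend u q.
    by apply: cvgD; apply: cvgM => //; exact: cvg_cst.
  rewrite -qE in hl.
  by rewrite -(extend_lim l3); exact: extend_lim hl.
have dN (v : R * R -> R) (p e : R * R) : derivable v p e -> 'D_(- e) v p = -1 * 'D_e v p.
  by move=> /derive_opp_dir ->; rewrite mulN1r.
have within_eq (f g : R * R -> R) (q : R * R) (l : R) : (forall p, square p -> f p = g p) ->
    f @ within (square (R:=R)) (nbhs q) --> l -> g @ within (square (R:=R)) (nbhs q) --> l.
  move=> fg hl A Al; have H : nbhs q [set p | square p -> A (f p)] := hl A Al.
  by apply: (filterS _ H) => p hp sp /=; rewrite -fg //; exact: hp.
have bb : `|b| = b by rewrite gtr0_norm.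
have bNb : `|- b| = b by rewrite normrN.
split.
- exact: cu.
- exact: cux.
- exact: cuy.
- by move=> x y /sqx/dxx[].
- by move=> x y /sqx/dyy[].
- move=> x y hxy; rewrite cE //; last exact: sqx.
  exact: extend_derive1 C1u hxy (is_derive_dirx (v := u) (dx _ (sqx _ _ hxy))).
- move=> x y hxy; rewrite cE //; last exact: sqx.
  exact: extend_derive2 C1u hxy (is_derive_diry (v := u) (dy _ (sqx _ _ hxy))).
- move=> x y hxy; have [d _] := dxx _ (sqx _ _ hxy).
  exact: extend_derive1 C1ux hxy (is_derive_dirx (v := ux) d).
- move=> x y hxy; have [d _] := dyy _ (sqx _ _ hxy).
  exact: extend_derive2 C1uy hxy (is_derive_diry (v := uy) d).
- move=> x y /sqx sp; rewrite cE // mulNr -pde // /laplacian opprK //.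
- apply: eq_closed_segment; [exact: slice_cont2|by have := slice_cont2 b cu => ?; cont|].
  move=> y yb; suff : 1 * extend ux (b, y) + h * extend u (b, y) = 0 by lra.
  apply: side; [by rewrite /= bb|exact: ltW|exact: eux|].
  apply: (@within_eq (fun p => 'D_(dirx R) u p + h * u p)); first by move=> p _; rewrite mul1r.
  apply: rob; apply: normal_right.
  by move: yb; rewrite ltr_norml.
- apply: eq_closed_segment; [exact: slice_cont2|by have := slice_cont2 (- b) cu => ?; cont|].
  move=> y yb; suff : -1 * extend ux (- b, y) + h * extend u (- b, y) = 0 by lra.
  apply: side; [by rewrite /= bNb|exact: ltW|exact: eux|].
  apply: (@within_eq (fun p => 'D_(- dirx R) u p + h * u p)).
    by move=> p sp; rewrite dN //; exact: dx.
  apply: rob; apply: normal_left.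
  by move: yb; rewrite ltr_norml.
- apply: eq_closed_segment; [exact: slice_cont1|by have := slice_cont1 b cu => ?; cont|].
  move=> y yb; suff : 1 * extend uy (y, b) + h * extend u (y, b) = 0 by lra.
  apply: side; [exact: ltW|by rewrite /= bb|exact: euy|].
  apply: (@within_eq (fun p => 'D_(diry R) u p + h * u p)); first by move=> p _; rewrite mul1r.
  apply: rob; apply: normal_top.
  by move: yb; rewrite ltr_norml.
- apply: eq_closed_segment; [exact: slice_cont1|by have := slice_cont1 (- b) cu => ?; cont|].
  move=> y yb; suff : -1 * extend uy (y, - b) + h * extend u (y, - b) = 0 by lra.
  apply: side; [exact: ltW|by rewrite /= bNb|exact: euy|].
  apply: (@within_eq (fun p => 'D_(- diry R) u p + h * u p)).
    by move=> p sp; rewrite dN //; exact: dy.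
  apply: rob; apply: normal_bottom.
  by move: yb; rewrite ltr_norml.
Qed.

End EigenfunctionToSolution.

(** * The combinations of the two products *)

Section Swap.
Variable R : realType.
Implicit Types (u : R * R -> R) (A : set (R * R)) (p : R * R).

Definition swap p : R * R := (p.2, p.1).

Fact swapK : involutive swap. Proof. by case. Qed.

Fact swap_continuous : continuous swap. Proof. by rewrite /swap; cont. Qed.

Lemma connected_component_swap A p :
  connected_component (swap @^-1` A) p = swap @^-1` connected_component A (swap p).
Proof.
have half B q : swap @` connected_component B q `<=` connected_component (swap @` B) (swap q).
  move=> _ [z [C [Cq CB cC] Cz] <-]; exists (swap @` C); last by exists z.
  split; [by exists q|exact: image_subset|].
  by apply: connected_continuous_connected => //; apply: continuous_subspaceT; exact: swap_continuous.
have preE B : swap @^-1` B = swap @` B.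
  by apply/seteqP; split => [z Bz|_ [z Bz <-]]; [exists (swap z); rewrite ?swapK|rewrite /= swapK].
apply/seteqP; split => z hz.
  have := half (swap @^-1` A) p (swap z) (ex_intro2 _ _ z hz erefl).
  by rewrite -preE (_ : swap @^-1` (swap @^-1` A) = A) //; apply/seteqP; split => w; rewrite /= swapK.
have H := half A (swap p) z; rewrite swapK in H; rewrite preE; apply: H.
by exists (swap z); rewrite ?swapK.
Qed.

Lemma has_nodal_domains_swap u n : has_nodal_domains u n ->
  has_nodal_domains (fun p => u (swap p)) n.
Proof.
rewrite /has_nodal_domains; apply: card_eq_trans.
have e : nodal_domains (fun p => u (swap p)) = (preimage swap) @` nodal_domains u.
  have sA : square (R:=R) `\` (fun p => u (swap p)) @^-1` [set 0] =
     swap @^-1` (square (R:=R) `\` u @^-1` [set 0]).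
    apply/seteqP; split => -[x y] [sp np]; split => //; move: sp; rewrite /square /= => /andP[h1 h2];
    by rewrite h1 h2.
  rewrite /nodal_domains sA; apply/seteqP; split.
    move=> _ [p Ap <-]; rewrite connected_component_swap.
    by exists (connected_component (square (R:=R) `\` u @^-1` [set 0]) (swap p)) => //; exists (swap p).
  move=> _ [_ [p Ap <-] <-]; exists (swap p); first by rewrite /= swapK.
  by rewrite connected_component_swap swapK.
rewrite e; apply: inj_card_eq => C D _ _ /(congr1 (preimage swap)) CD.
apply/seteqP; split => z; have : (swap @^-1` (swap @^-1` C)) z = (swap @^-1` (swap @^-1` D)) z by rewrite CD.
  by rewrite /= swapK => ->.
by rewrite /= swapK => ->.
Qed.

End Swap.

Section RobinFamily.
Variable R : realType.
Variables (h : R) (s : nat -> R).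
Hypothesis h_large : h_threshold R < h.
Hypothesis s_angle : forall j, (j <= 2)%N -> robin_angle j h (s j).
Implicit Types (x y t a c : R).
Let b : R := pi / 2.
Local Notation k0 := (freq s 0).
Local Notation k2 := (freq s 2).
Let A x : R := cos (k0 * x).
Let B x : R := cos (k2 * x).
Let r x : R := B x / A x.
Let q : R := r b.

Fact A_pos x : `|x| <= b -> 0 < A x.
Proof.
have f0 := freq_bounds h_large s_angle (isT : (0 <= 2)%N); have b0 : 0 < b := pihalf_gt0 R.
move=> xb; apply: cos_gt0_pihalf; rewrite -/b -ltr_norml normrM gtr0_norm; last lra.
apply: le_lt_trans (_ : k0 * b < b); first by rewrite ler_wpM2l //; lra.
by rewrite gtr_pMl //; lra.
Qed.

Fact cos_neg (z : R) : pi / 2 < z < 3 / 2 * pi -> cos z < 0.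
Proof.
move=> hz; rewrite -(subrK pi z) cosDpi oppr_lt0; apply: cos_gt0_pihalf; lra.
Qed.

(** The Wronskian of the two factors vanishes at [0] by parity and at the side
    by the common Robin condition; its derivative has the sign of [- A * B], so
    it decreases and then increases, hence is negative in between. *)
Lemma wronskian_lt0 x : 0 < x < b ->
  - k2 * sin (k2 * x) * A x - B x * (- k0 * sin (k0 * x)) < 0.
Proof.
move=> hx; have b0 : 0 < b := pihalf_gt0 R.
have f0 := freq_bounds h_large s_angle (isT : (0 <= 2)%N).
have f2 := freq_bounds h_large s_angle (isT : (2 <= 2)%N).
have m0 := mode0 s_angle; have m2 := mode2 s_angle.
pose W z := - k2 * sin (k2 * z) * A z - B z * (- k0 * sin (k0 * z)).
pose W1 z := (k0 ^+ 2 - k2 ^+ 2) * (A z * B z).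
have dW (z : R) : is_derive z 1 W (W1 z) by rewrite /W /W1 /A /B; derive_with; ring.
have cW : continuous W by rewrite /W /A /B; cont.
have W0 : W 0 = 0 by rewrite /W !mulr0 !sin0; ring.
have Wb : W b = 0.
  by rewrite /W /A /B (mode_right m0) (mode_right m2); ring.
have kk : k0 ^+ 2 - k2 ^+ 2 < 0 by move: f0 f2; move: k0 k2 => u v; nra.
have k2p : 0 < k2 by lra.
have k2b : k2 * b < 3 / 2 * pi by rewrite freq_side; have := angle_bounds h_large s_angle (isT : (2 <= 2)%N); lra.
rewrite -/(W x); have [xs|xs] := leP (k2 * x) (pi / 2).
  have x0 : 0 < x by lra.
  have [z] := @MVT _ W W1 0 x x0 (fun z _ => dW z) (cont_within cW).
  rewrite in_itv /= W0 !subr0 => hz ->.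
  rewrite pmulr_llt0 // /W1 nmulr_rlt0 // mulr_gt0 //.
    by apply: A_pos; rewrite ler_norml; lra.
  have z1 : 0 < k2 * z by apply: mulr_gt0; lra.
  have z2 : k2 * z < k2 * x by rewrite ltr_pM2l //; lra.
  by apply: cos_gt0_pihalf; lra.
have xb : x < b by lra.
have [z] := @MVT _ W W1 x b xb (fun z _ => dW z) (cont_within cW).
rewrite in_itv /= Wb sub0r => hz e.
have : 0 < W1 z * (b - x).
  rewrite pmulr_lgt0 ?subr_gt0 // /W1 nmulr_rgt0 // pmulr_rlt0; last first.
    by apply: A_pos; rewrite ler_norml; lra.
  have z1 : k2 * x < k2 * z by rewrite ltr_pM2l //; lra.
  have z2 : k2 * z < k2 * b by rewrite ltr_pM2l //; lra.
  by apply: cos_neg; lra.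
by rewrite -e oppr_gt0.
Qed.

Lemma ratio_decreasing x y : 0 <= x -> x < y -> y <= b -> r y < r x.
Proof.
move=> x0 xy yb; have b0 : 0 < b := pihalf_gt0 R.
pose r1 (z : R) : R := (- k2 * sin (k2 * z) * A z - B z * (- k0 * sin (k0 * z))) / A z ^+ 2.
have Ap z : 0 <= z <= b -> 0 < A z by move=> hz; apply: A_pos; rewrite ler_norml; lra.
have dr (z : R) : 0 <= z <= b -> is_derive z 1 r (r1 z).
  move=> /Ap A0; have An : A z != 0 by rewrite gt_eqF.
  have dA : is_derive z 1 A (- k0 * sin (k0 * z)) by rewrite /A; derive_with; ring.
  have dB : is_derive z 1 B (- k2 * sin (k2 * z)) by rewrite /B; derive_with; ring.
  have dV : is_derive z 1 (fun y => (A y)^-1) (- (A z) ^- 2 *: (- k0 * sin (k0 * z))).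
    exact: (@is_deriveV R A z _ 1 An dA).
  rewrite /r /r1; move: dB dA dV An; move: (sin _) (sin _) => S S' dB dA dV An.
  derive_with; rewrite /GRing.scale /=; move: (A z) (B z) An => u v un.
  by field.
have [||w] := @MVT _ r r1 x y xy.
- by move=> z; rewrite in_itv /= => hz; apply: dr; lra.
- apply: continuous_in_subspaceT => z /set_mem /=; rewrite in_itv /= => hz.
  have hz' : 0 <= z <= b by lra.
  exact: der_cont (dr z hz').
rewrite in_itv /= => hw e; rewrite -subr_lt0 e pmulr_llt0 ?subr_gt0 // /r1.
have hw' : 0 < w < b by lra.
rewrite pmulr_llt0; first exact: wronskian_lt0.
by rewrite invr_gt0 exprn_gt0 // Ap //; lra.
Qed.

(** By the Robin equations [- q] is the quotient of [k2 * cos (s 2)] by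
    [k0 * cos (s 0)], which tends to [3]. *)
Lemma ratio_side_lt : q < -1.
Proof.
have f0 := freq_bounds h_large s_angle (isT : (0 <= 2)%N).
have f2 := freq_bounds h_large s_angle (isT : (2 <= 2)%N).
have a0 := angle_bounds h_large s_angle (isT : (0 <= 2)%N).
have a2 := angle_bounds h_large s_angle (isT : (2 <= 2)%N).
have e0 := freq_eq s_angle (isT : (0 <= 2)%N).
have e2 := freq_eq s_angle (isT : (2 <= 2)%N).
have p0 := pi_gt0 R; have mE : margin R = pi / 16 by [].
have h0 := h_gt0 h_large.
have Ab : A b = sin (s 0) by rewrite /A freq_side mul1r cosB sin_pihalf cos_pihalf; lra.
have Bb : B b = - sin (s 2).
  rewrite /B freq_side; have -> : 3%:R * (pi / 2) - s 2%N = pi / 2 - s 2%N + pi :> R by lra.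
  by rewrite cosDpi cosB sin_pihalf cos_pihalf; lra.
have s0 : 0 < sin (s 0) by apply: sin_gt0_pihalf; lra.
rewrite /q /r Ab Bb ltr_pdivrMr // mulN1r ltrN2 -(ltr_pM2l h0) -e0 -e2.
have cm : sin (margin R) < cos (margin R).
  have -> : cos (margin R) = sin (pi / 2 - margin R) by rewrite sinB sin_pihalf cos_pihalf; lra.
  by rewrite ltr_sin ?in_itv /= ?mE; lra.
have cm2 : 1 / 2 < cos (margin R).
  have := cos2Dsin2 (margin R); have := sin_margin_gt0 R; move: cm.
  move: (sin _) (cos _) => S C SC S0 e; rewrite ltNge; apply/negP => C2; nra.
have c2 : cos (margin R) <= cos (s 2) by apply: cos_le_pihalf; lra.
have c0 : cos (s 0) <= 1 by exact: cos_le1.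
have c00 : 0 < cos (s 0) by apply: cos_gt0_pihalf; lra.
have l1 : k0 * cos (s 0) <= 1 * 1 by apply: ler_pM; lra.
have l2 : 23 / 8 * (1 / 2) <= k2 * cos (s 2) by apply: ler_pM; lra.
lra.
Qed.

Fact factors_even x : A (- x) = A x /\ B (- x) = B x.
Proof. by rewrite /A /B !mulrN !cosN. Qed.

Fact ratio0 : r 0 = 1. Proof. by rewrite /r /A /B !mulr0 cos0 divr1. Qed.

Fact cont_A : continuous A. Proof. by rewrite /A; cont. Qed.
Fact cont_B : continuous B. Proof. by rewrite /B; cont. Qed.

Local Notation fam := (nodal_family A B).

Lemma fam_three t : -1 < t -> t * q >= -1 -> has_nodal_domains (fam t) 3.
Proof.
apply: (three_domains (erefl b) cont_A cont_B A_pos (fun x => (factors_even x).1)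
  (fun x => (factors_even x).2) ratio0 ratio_decreasing ratio_side_lt).
Qed.

Lemma fam_two t : 0 < t -> t * q < -1 -> t + q < 0 -> has_nodal_domains (fam t) 2.
Proof.
apply: (two_domains (erefl b) cont_A cont_B A_pos (fun x => (factors_even x).1)
  (fun x => (factors_even x).2) ratio0 ratio_decreasing).
Qed.

Lemma fam_four : has_nodal_domains (fam (-1)) 4.
Proof.
apply: (four_domains (erefl b) A_pos (fun x => (factors_even x).1)
  (fun x => (factors_even x).2) ratio_decreasing).
Qed.

Definition combination a c (p : R * R) : R := a * (A p.1 * B p.2) + c * (B p.1 * A p.2).

Lemma combination_fam a c n : a != 0 -> has_nodal_domains (fam (c / a)) n ->
  has_nodal_domains (combination a c) n.
Proof.
move=> a0; apply: has_nodal_domains_eq => p _.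
have -> : combination a c p = a * fam (c / a) p.
  by rewrite /combination /nodal_family; move: (A _) (B _) (A _) (B _) => x1 x2 x3 x4; field.
by rewrite mulf_eq0 (negbTE a0).
Qed.

Lemma combination_fam_swap a c n : c != 0 -> has_nodal_domains (fam (a / c)) n ->
  has_nodal_domains (combination a c) n.
Proof.
move=> c0 /has_nodal_domains_swap; apply: has_nodal_domains_eq => p _.
have -> : combination a c p = c * fam (a / c) (swap p).
  by rewrite /combination /nodal_family /=; move: (A _) (B _) (A _) (B _) => x1 x2 x3 x4; field.
by rewrite mulf_eq0 (negbTE c0).
Qed.

(** For [a != 0] and [t = c / a], the cases are [-1 < t <= - 1 / q], [- 1 / q < t < - q] and
    [t = -1]; the values [t >= - q] and [t < -1] have [1 / t] in the first range. *)
Lemma combination_count a c : (a != 0) || (c != 0) ->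
  [\/ has_nodal_domains (combination a c) 2, has_nodal_domains (combination a c) 3
    | has_nodal_domains (combination a c) 4].
Proof.
move=> ac; have q1 := ratio_side_lt.
have [a0|a0] := eqVneq a 0.
  rewrite a0 eqxx /= in ac; apply: Or32; apply: combination_fam_swap => //.
  by apply: fam_three; rewrite a0 mul0r ?mul0r; lra.
have [t1|t1|t1] := ltgtP (-1) (c / a).
- have [tq|tq] := leP (-1) (c / a * q).
    by apply: Or32; apply: combination_fam => //; exact: fam_three.
  have [tq'|tq'] := ltP (c / a + q) 0.
    apply: Or31; apply: combination_fam => //; apply: fam_two => //.
    rewrite ltNge; apply/negP => t0.
    have : 0 <= c / a * q by rewrite mulr_le0 //; lra.
    lra.
  have t0 : 0 < c / a by lra.
  have c0 : c != 0 by apply/eqP => c0; move: t0; rewrite c0 mul0r ltxx.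
  apply: Or32; apply: combination_fam_swap => //.
  have ti : a / c = (c / a)^-1 by rewrite invf_div.
  rewrite ti; apply: fam_three; first by have : 0 < (c / a)^-1 by [rewrite invr_gt0]; lra.
  by rewrite -(ler_pM2l t0) mulrA mulfV ?gt_eqF // mul1r; lra.
- have c0 : c != 0 by apply/eqP => c0; move: t1; rewrite c0 mul0r; lra.
  apply: Or32; apply: combination_fam_swap => //.
  have ti : a / c = (c / a)^-1 by rewrite invf_div.
  have tn : c / a < 0 by lra.
  have i0 : (c / a)^-1 < 0 by rewrite invr_lt0.
  rewrite ti; apply: fam_three.
    by rewrite -(ltr_nM2l tn) mulfV ?lt_eqF //; lra.
  have : 0 <= (c / a)^-1 * q by rewrite mulr_le0 //; lra.
  lra.
- by apply: Or33; apply: combination_fam => //; rewrite -t1; exact: fam_four.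
Qed.

Lemma eigenfunction_count u : robin_eigenfunction h (lam02 s) u ->
  [\/ has_nodal_domains u 2, has_nodal_domains u 3 | has_nodal_domains u 4].
Proof.
move=> eig; have [[C1u _] _ [p0 sp0 up0] _ _] := eig.
have [a [c uE]] := robin_solution_family h_large s_angle (eigenfunction_solution eig).
have {}uE p : square p -> u p = combination a c p.
  move=> sp; have eU : extend u p = u p by apply: extend_eq => //; case: (C1u p sp).
  by have := uE p.1 p.2 ((square_box p).1 sp); rewrite -surjective_pairing eU.
have ac : (a != 0) || (c != 0).
  apply: contraNT up0; rewrite negb_or !negbK => /andP[/eqP a0 /eqP c0].
  by rewrite uE // /combination a0 c0 !mul0r addr0.
have eqn n : has_nodal_domains (combination a c) n -> has_nodal_domains u n.
  by apply: has_nodal_domains_eq => p sp; rewrite uE.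
by case: (combination_count ac) => /eqn; [apply: Or31|apply: Or32|apply: Or33].
Qed.

End RobinFamily.

Section Angles.
Variable R : realType.
Implicit Types (q theta : R).

Fact tan_le (x y : R) : - (pi / 2) < x -> x <= y -> y < pi / 2 -> tan x <= tan y.
Proof.
move=> hx xy hy; have [->//|nxy] := eqVneq x y.
by apply/ltW; rewrite ltr_tan ?in_itv /=; rewrite ?lt_neqAle ?nxy //; lra.
Qed.

Fact tan_lt (x y : R) : - (pi / 2) < x -> x < y -> y < pi / 2 -> tan x < tan y.
Proof. by move=> hx xy hy; rewrite ltr_tan ?in_itv //=; lra. Qed.

(** Since [- 1 / q] is below [1], the first critical angle is below [pi / 4], which
    orders the three angles. *)
Lemma critical_angles q : q < -1 ->
  [/\ 0 < atan (- q^-1) < pi / 4, tan (atan (- q^-1)) = - q^-1 & 0 < - q^-1 < 1].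
Proof.
move=> q1; have i0 : 0 < - q^-1 < 1.
  have q0 : q < 0 by lra.
  rewrite -invrN invr_gt0 invf_lt1 ?oppr_gt0 //; lra.
split => //; last by rewrite atanK.
rewrite -atan1 -(atan0 R); case/andP: i0 => h1 h2.
by rewrite !lt_atan.
Qed.

End Angles.

(** * The theorem *)

Theorem proposition6p1 (R : realType) :
  exists h0 : R, 0 < h0 /\
  forall h : R, h0 < h ->
    (forall u : R * R -> R, robin_eigenfunction h (lambda02 h) u ->
       [\/ has_nodal_domains u 2, has_nodal_domains u 3 | has_nodal_domains u 4])
    /\ [/\ 0 <= theta1 h, theta1 h < theta2 h, theta2 h < theta3 & (theta3 : R) < pi]
    /\ [/\ (forall theta : R, 0 <= theta <= theta1 h ->
              has_nodal_domains (Phi h theta) 3),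
           (forall theta : R, theta1 h < theta < theta2 h ->
              has_nodal_domains (Phi h theta) 2),
           (forall theta : R, theta2 h <= theta < theta3 ->
              has_nodal_domains (Phi h theta) 3),
           has_nodal_domains (Phi h theta3) 4
         & (forall theta : R, theta3 < theta < pi ->
              has_nodal_domains (Phi h theta) 3)].
Proof.
exists (h_threshold R); split => [|h hh]; first exact: h_threshold_gt0.
have h0 : 0 < h by exact: lt_trans (h_threshold_gt0 R) hh.
have p0 := pi_gt0 R.
have [s0 a0 e0] := alpha_robin_angle (or_introl (erefl 0%N)) h0.
have [s2 a2 e2] := alpha_robin_angle (or_intror (erefl 2%N)) h0.
have [s1 a1] := robin_angle_exists 1 h0.
(* The angle [s1] of the odd mode is not determined by the statement; any root will do. *)
pose s j := if j is j'.+1 then (if j' is 0%N then s1 else s2) else s0.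
have sa j : (j <= 2)%N -> robin_angle j h (s j) by case: j => [|[|[|]]].
have freqE (j : nat) (t : R) : j.+1%:R * pi - 2 * t = pi * (j.+1%:R - t / (pi / 2)).
  have pn0 : pi != 0 :> R by rewrite gt_eqF.
  by move: (pi : R) pn0 => P Pn; field.
have k0E : alpha 0 h = pi * freq s 0 by rewrite e0 freqE.
have k2E : alpha 2 h = pi * freq s 2 by rewrite e2 freqE.
have pn0 : pi != 0 :> R by rewrite gt_eqF.
have lamE : lambda02 h = lam02 s.
  rewrite /lambda02 /lam02 k0E k2E; move: (freq s 0) (freq s 2) (pi : R) pn0 => x y P Pn.
  by field.
have PhiE theta p : Phi h theta p = combination s (cos theta) (sin theta) p.
  have kx k x : pi * k * x / pi = k * x :> R by rewrite mulrAC [pi * k]mulrC mulfK.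
  by rewrite /Phi /combination k0E k2E !kx; ring.
have qE : q2 h = cos (freq s 2 * (pi / 2)) / cos (freq s 0 * (pi / 2)).
  by rewrite /q2 k0E k2E; congr (cos _ / cos _); ring.
have q1 := ratio_side_lt hh sa; rewrite -qE in q1.
have [t1 tan1 iq] := critical_angles q1.
rewrite -/(theta1 h) in t1 tan1.
have q0 : q2 h < 0 by lra.
have qn : q2 h != 0 by rewrite lt_eqF.
have iqq : - (q2 h)^-1 * q2 h = -1 by rewrite mulNr mulVf.
have three a c : a != 0 -> -1 < c / a -> c / a <= - (q2 h)^-1 ->
    has_nodal_domains (combination s a c) 3.
  move=> an c1 c2; apply: combination_fam => //; apply: (fam_three hh sa) => //.
  by rewrite -qE -iqq ler_wnM2r // ltW.
have three' a c : c != 0 -> -1 < a / c -> a / c <= - (q2 h)^-1 ->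
    has_nodal_domains (combination s a c) 3.
  move=> cn c1 c2; apply: combination_fam_swap => //; apply: (fam_three hh sa) => //.
  by rewrite -qE -iqq ler_wnM2r // ltW.
have PhiN theta n : has_nodal_domains (combination s (cos theta) (sin theta)) n ->
    has_nodal_domains (Phi h theta) n.
  by apply: has_nodal_domains_eq => p _; rewrite PhiE.
(* Beyond [pi / 2] the tangent and the sign of the cosine are read off [theta - pi]. *)
have tan_shift theta : tan theta = tan (theta - pi) :> R by rewrite -[in LHS](subrK pi theta) tanDpi.
have cos_shift theta : cos theta = - cos (theta - pi) :> R by rewrite -[in LHS](subrK pi theta) cosDpi.
have tan_q : tan (- (pi / 4)) = -1 :> R by rewrite tanN tan_piquarter.
split; first by move=> u; rewrite lamE; exact: eigenfunction_count.
split; first by rewrite /theta2 /theta3; split; lra.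
split.
- move=> theta ht; apply: PhiN; have c0 : 0 < cos theta by apply: cos_gt0_pihalf; lra.
  have tl : tan theta <= - (q2 h)^-1 by rewrite -tan1; apply: tan_le; lra.
  have tg : 0 <= tan theta by rewrite -(tan0 R); apply: tan_le; lra.
  by apply: three; rewrite ?gt_eqF // -/(tan theta); lra.
- move=> theta; rewrite /theta2 => ht; apply: PhiN.
  have c0 : 0 < cos theta by apply: cos_gt0_pihalf; lra.
  have tg : - (q2 h)^-1 < tan theta by rewrite -tan1; apply: tan_lt; lra.
  have tl : tan theta < - q2 h.
    have -> : - q2 h = tan (pi / 2 - theta1 h).
      by rewrite tan_robin_angle -[RHS]invrK invf_div -/(tan (theta1 h)) tan1 -invrN invrK.
    by apply: tan_lt; lra.
  apply: combination_fam; first by rewrite gt_eqF.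
  apply: (fam_two hh sa); rewrite -/(tan theta) -?qE; [lra| |lra].
  by rewrite -iqq ltr_nM2r.
- move=> theta; rewrite /theta2 /theta3 => ht; apply: PhiN.
  have c0 : 0 < sin theta by apply: sin_gt0_pi; lra.
  have cotE : cos theta / sin theta = tan (pi / 2 - theta) by rewrite tan_robin_angle.
  apply: three'; rewrite ?gt_eqF // cotE.
    by rewrite -tan_q; apply: tan_lt; lra.
  by rewrite -tan1; apply: tan_le; lra.
- apply: PhiN; have tm : tan (theta3 : R) = -1.
    by rewrite tan_shift -tan_q; congr tan; rewrite /theta3; lra.
  have cn : cos (theta3 : R) != 0.
    by rewrite cos_shift oppr_eq0 gt_eqF // cos_gt0_pihalf // /theta3; lra.
  by apply: combination_fam => //; rewrite -/(tan theta3) tm; exact: (fam_four hh sa).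
- move=> theta; rewrite /theta3 => ht; apply: PhiN.
  have c0 : cos theta != 0.
    by rewrite cos_shift oppr_eq0 gt_eqF // cos_gt0_pihalf //; lra.
  have tg : -1 < tan theta by rewrite tan_shift -tan_q; apply: tan_lt; lra.
  have tl : tan theta <= tan 0 by rewrite tan_shift; apply: tan_le; lra.
  by rewrite tan0 in tl; apply: three => //; rewrite -/(tan theta); lra.
Qed.
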